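(* Let $\mathbf{d}=\{d_n\}_{n=1}^\infty\in\mathcal{D}$ and $T\in\mathbb{N}$. Suppose that there exist constants $0<c_1\le c_2<\infty$, $c_3>0$, $\gamma>1$ and $N\in\mathbb{N}$ such that for all $n\ge N$, $c_1n^\gamma\le d_n\le c_2n^\gamma$ and $d_{n+1}-d_n\ge c_3n^{\gamma-1}$ hold, and that $c_1N^\gamma>1$. Suppose also that $\mathcal{F}(\mathbf{d},T)$ and $\mathcal{G}(\mathbf{d},T)$ are CIFSs. For $l\in\mathbb{N}$, let $$\mathcal{F}^{(l)}:=\mathcal{F}(\{d_n\}_{n=l}^\infty,T),\qquad \mathcal{G}^{(l)}:=\mathcal{G}(\{d_n\}_{n=l}^\infty,T).$$ Then there exists $q=q(\mathbf{d},T)\in\mathbb{N}$ such that for all $l\in\mathbb{N}$ with $l\ge q$, $$\dim_H(J_{\mathcal{F}^{(l)}})<\underline{\dim}_B(J_{\mathcal{F}^{(l)}})\le\overline{\dim}_B(J_{\mathcal{F}^{(l)}})=\dim_P(J_{\mathcal{F}^{(l)}}),$$ $$\dim_H(J_{\mathcal{G}^{(l)}})<\underline{\dim}_B(J_{\mathcal{G}^{(l)}})\le\overline{\dim}_B(J_{\mathcal{G}^{(l)}})=\dim_P(J_{\mathcal{G}^{(l)}}).$$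
   Context: Notation. $\mathbb{N}$ is the set of positive integers, $\mathbb{D}=\{z\in\mathbb{C}:|z|<1\}$, $\mathbb{C}$ is identified with $\mathbb{R}^2$, $e(\theta)=e^{2\pi\sqrt{-1}\,\theta}$. $\dim_H,\dim_P,\underline{\dim}_B,\overline{\dim}_B$ are Hausdorff, packing, lower box and upper box dimension. The sequence $\{d_n\}_{n=l}^\infty$ is regarded as a sequence indexed by $\mathbb{N}$ via $n\mapsto d_{n+l-1}$. CIFS. Let $X\subset\mathbb{R}^d$ be compact and connected and $I$ a countable (possibly finite) set with at least two elements. A family $\mathcal{S}=\{s_i:X\to X\}_{i\in I}$ of injective contractions is an IFS if $\sup_{i}\mathrm{Lip}(s_i)<1$. For $\omega=(\omega_1,\dots,\omega_N)\in I^N$ put $s_\omega=s_{\omega_1}\circ\dots\circ s_{\omega_N}$. The limit set is $J_{\mathcal{S}}=\bigcup_{\omega\in I^{\mathbb{N}}}\bigcap_{N\ge1}s_{\omega|_N}(X)$, where $\omega|_N=(\omega_1,\dots,\omega_N)$. An IFS $\mathcal{S}$ is a conformal IFS (CIFS) if: (Open Set Condition) $s_i(\mathrm{Int}\,X)\cap s_j(\mathrm{Int}\,X)=\emptyset$ for $i\ne j$; (Cone Condition) there are $0<\alpha<\pi/2$, $l>0$ such that for every $x\in\partial X$ there is $u_x\neq0$ with $\{y:0<|y-x|<l,\ \langle y-x,u_x\rangle>|y-x||u_x|\cos\alpha\}\subset\mathrm{Int}(X)$; (Conformality) there is an open connected $V\supset X$ such that all $s_i$ extend to $C^{1+\varepsilon}$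 diffeomorphisms on $V$ that are conformal on $V$; (Bounded Distortion) there is $K\ge1$ with $|s_\omega'(y)|\le K|s_\omega'(x)|$ for all $\omega\in\bigcup_N I^N$, $x,y\in V$, where $|s'_\omega(x)|$ is the operator norm of the derivative. The systems. $\mathcal{D}$ is the set of real sequences $\{d_n\}_{n\ge1}$ with $d_1\ge2$ and $d_{n+1}-d_n\ge2$ for all $n$. For $\alpha\in\mathbb{C}$, $|\alpha|\ge2$, define $f_\alpha,g_\alpha:\overline{\mathbb{D}}\to\overline{\mathbb{D}}$ by $f_\alpha(z)=\frac{z+\overline{\alpha}}{|\alpha|^2-1}$, $g_\alpha(z)=\frac1{z+\alpha}$. For $\mathbf{d}=\{d_n\}\in\mathcal{D}$, $T\in\mathbb{N}$: $\mathcal{F}(\mathbf{d},T)=\{f_{e(j/T)d_n}:n\in\mathbb{N},\,j=0,\dots,T-1\}$ and $\mathcal{G}(\mathbf{d},T)=\{g_{e(j/T)d_n}:n\in\mathbb{N},\,j=0,\dots,T-1\}$, families of maps on $X=\overline{\mathbb{D}}$. *)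

(* Defs.v *)
From HB Require Import structures.
From mathcomp Require Export all_boot all_order all_algebra.
From mathcomp Require Export complex.
From mathcomp Require Export all_classical all_reals all_analysis.
Export numFieldNormedType.Exports.

Set Implicit Arguments.
Unset Strict Implicit.
Unset Printing Implicit Defensive.

Import Order.TTheory GRing.Theory Num.Theory.

Local Open Scope classical_set_scope.
Local Open Scope ring_scope.

(* The library norm on 'rV[R]_d is the sup norm.  It is used below only through
   the topology and the differential, which do not depend on the choice of
   norm; all metric notions use the Euclidean norm [enorm]. *)
Section Euclidean.
Variables (R : realType) (d : nat).
Implicit Types (u v x : 'rV[R]_d) (F U : set 'rV[R]_d).

Definition edot u v : R := \sum_(k < d) u ord0 k * v ord0 k.

Definition enorm u : R := Num.sqrt (edot u u).

Definition ecball x (r : R) : set 'rV[R]_d := [set y | enorm (y - x) <= r].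

(* The added 0 only matters for U = set0, whose diameter is thus 0. *)
Definition ediam U : \bar R :=
  ereal_sup (0%E |` [set e | exists x y, U x /\ U y /\ e = (enorm (x - y))%:E]).

Definition opnorm (L : 'rV[R]_d -> 'rV[R]_d) : R :=
  sup [set enorm (L v) | v in [set v | enorm v <= 1]].

(* +oo when f is not Lipschitz on X *)
Definition Lip (X : set 'rV[R]_d) (f : 'rV[R]_d -> 'rV[R]_d) : \bar R :=
  ereal_inf [set c%:E | c in [set c : R | 0 <= c /\
    forall x y, X x -> X y -> enorm (f x - f y) <= c * enorm (x - y)]].

End Euclidean.

Section Dimensions.
Variables (R : realType) (d : nat).
Implicit Types (F U : set 'rV[R]_d) (s delta : R).

(* |U|^s.  The convention 0 `^ 0 = 1 of the library makes the 0-dimensional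
   Hausdorff measure the counting measure, provided that empty sets have
   weight 0. *)
Definition gauge s U : \bar R :=
  (if U == set0 then 0 else ediam U `^ s)%E.

Definition hausdorff_premeasure s delta F : \bar R :=
  ereal_inf [set e | exists U : nat -> set 'rV[R]_d,
    F `<=` \bigcup_k U k /\
    (forall k, (ediam (U k) <= delta%:E)%E) /\
    e = (\sum_(0 <= k <oo) gauge s (U k))%E].

Definition hausdorff_measure s F : \bar R :=
  ereal_sup [set hausdorff_premeasure s delta F | delta in [set r : R | 0 < r]].

Definition hausdorff_dim F : \bar R :=
  ereal_inf [set s%:E | s in
    [set s : R | 0 <= s /\ hausdorff_measure s F = 0%E]].

(* Countable families of disjoint closed balls centred in F with radii at most
   delta; the family is indexed by an arbitrary set D of naturals, so that
   finite and empty families are included. *)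
Definition packing_premeasure_at s delta F : \bar R :=
  ereal_sup [set e | exists (D : set nat) (c : nat -> 'rV[R]_d) (r : nat -> R),
    (forall k, D k -> F (c k) /\ 0 < r k <= delta) /\
    trivIset D (fun k => ecball (c k) (r k)) /\
    e = (\esum_(k in D) ((2 * r k) `^ s)%:E)%E].

Definition packing_premeasure s F : \bar R :=
  ereal_inf [set packing_premeasure_at s delta F | delta in [set r : R | 0 < r]].

Definition packing_measure s F : \bar R :=
  ereal_inf [set e | exists A : nat -> set 'rV[R]_d,
    F `<=` \bigcup_k A k /\
    e = (\sum_(0 <= k <oo) packing_premeasure s (A k))%E].

Definition packing_dim F : \bar R :=
  ereal_inf [set s%:E | s in
    [set s : R | 0 <= s /\ packing_measure s F = 0%E]].

(* smallest number of sets of diameter at most delta covering F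
   (+oo if there is no finite cover) *)
Definition covering_number F delta : \bar R :=
  ereal_inf [set e | exists (n : nat) (U : 'I_n -> set 'rV[R]_d),
    F `<=` \bigcup_k U k /\
    (forall k, (ediam (U k) <= delta%:E)%E) /\
    e = (n%:R)%:E].

Definition box_ratio F delta : \bar R :=
  (lne (covering_number F delta) * ((- ln delta)^-1)%:E)%E.

Definition lower_box_dim F : \bar R := limf_einf (box_ratio F) (0 : R)^'+.

Definition upper_box_dim F : \bar R := limf_esup (box_ratio F) (0 : R)^'+.

End Dimensions.

Section IteratedFunctionSystems.
Variables (R : realType) (d : nat) (I : Type).
Implicit Types (X V : set 'rV[R]_d) (s t : I -> 'rV[R]_d -> 'rV[R]_d).

(* Maps X -> X are represented by total functions of which only the values on
   X matter. *)
Definition is_IFS X s : Prop :=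
  [/\ compact X /\ connected X,
      countable [set: I] /\ (exists i j : I, i <> j),
      forall i x, X x -> X (s i x),
      forall i x y, X x -> X y -> s i x = s i y -> x = y &
      (ereal_sup [set Lip X (s i) | i in [set: I]] < 1%:E)%E].

Definition word_map s (w : seq I) : 'rV[R]_d -> 'rV[R]_d :=
  foldr (fun i g => s i \o g) id w.

Definition limit_set X s : set 'rV[R]_d :=
  [set x | exists w : nat -> I,
     forall n, (0 < n)%N -> (word_map s (mkseq w n) @` X) x].

Definition open_set_condition X s : Prop :=
  forall i j, i <> j -> (s i @` X°) `&` (s j @` X°) = set0.

Definition cone_condition X : Prop :=
  exists alpha l : R,
    [/\ 0 < alpha, alpha < pi / 2, 0 < l &
     forall x, (closure X `\` X°) x ->
       exists2 u : 'rV[R]_d, u <> 0 &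
         [set y | 0 < enorm (y - x) < l /\
                  enorm (y - x) * enorm u * cos alpha < edot (y - x) u]
         `<=` X°].

(* The Hoelder condition on the derivative is local, with constants depending on
   the map. *)
Definition C1plus (eps : R) V (f : 'rV[R]_d -> 'rV[R]_d) : Prop :=
  (forall x, V x -> differentiable f x) /\
  (forall x, V x -> exists r C : R, 0 < r /\
     forall y z, V y -> V z -> enorm (y - x) < r -> enorm (z - x) < r ->
       opnorm (fun v => 'd f y v - 'd f z v) <= C * enorm (y - z) `^ eps).

(* C^(1+eps) diffeomorphism of V onto an open subset of V *)
Definition C1plus_diffeo (eps : R) V (f : 'rV[R]_d -> 'rV[R]_d) : Prop :=
  [/\ f @` V `<=` V, open (f @` V), C1plus eps V f &
   exists2 h : 'rV[R]_d -> 'rV[R]_d,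
     forall x, V x -> h (f x) = x & C1plus eps (f @` V) h].

(* Orientation-reversing similarities are allowed as derivatives. *)
Definition conformal_on V (f : 'rV[R]_d -> 'rV[R]_d) : Prop :=
  forall x, V x ->
    exists2 lambda : R, 0 < lambda &
      forall v, enorm ('d f x v) = lambda * enorm v.

(* t i is the extension of s i to V; bounded distortion is a property of the
   extended maps on that same V. *)
Definition conformality_and_bounded_distortion X s : Prop :=
  exists V t,
    [/\ open V /\ connected V, X `<=` V,
        forall i x, X x -> t i x = s i x,
        (exists2 eps : R, 0 < eps &
           forall i, C1plus_diffeo eps V (t i) /\ conformal_on V (t i)) &
        exists2 K : R, 1 <= K &
          forall (w : seq I) x y, (0 < size w)%N -> V x -> V y ->
            opnorm ('d (word_map t w) y) <= K * opnorm ('d (word_map t w) x)].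

Definition is_CIFS X s : Prop :=
  [/\ is_IFS X s, open_set_condition X s, cone_condition X &
      conformality_and_bounded_distortion X s].

End IteratedFunctionSystems.

Section Systems.
Variable R : realType.
Local Open Scope complex_scope.

Definition C_to_R2 (z : R[i]) : 'rV[R]_2 :=
  \row_(k < 2) if k == ord0 then complex.Re z else complex.Im z.

Definition R2_to_C (v : 'rV[R]_2) : R[i] := v ord0 ord0 +i* v ord0 ord_max.

Definition on_R2 (h : R[i] -> R[i]) : 'rV[R]_2 -> 'rV[R]_2 :=
  C_to_R2 \o h \o R2_to_C.

Definition closed_disc : set 'rV[R]_2 :=
  C_to_R2 @` [set z : R[i] | `|z| <= 1].

Definition e2pi (theta : R) : R[i] :=
  cos (2 * pi * theta) +i* sin (2 * pi * theta).

Definition f_map (alpha z : R[i]) : R[i] := (z + alpha^*) / (`|alpha| ^+ 2 - 1).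

Definition g_map (alpha z : R[i]) : R[i] := 1 / (z + alpha).

(* Sequences are indexed by the positive integers: the value at 0 of a function
   nat -> R representing a sequence is never used. *)
Definition in_calD (d : nat -> R) : Prop :=
  2 <= d 1%N /\ forall n, (1 <= n)%N -> 2 <= d n.+1 - d n.

Definition shift_seq (l : nat) (d : nat -> R) : nat -> R :=
  fun n => d (n + l - 1)%N.

(* e(j/T) d_n, where the index (m, j) stands for n = m + 1 *)
Definition param (d : nat -> R) (T : nat) (p : nat * 'I_T) : R[i] :=
  e2pi ((p.2 : nat)%:R / T%:R) * (d p.1.+1)%:C.

Definition calF (d : nat -> R) (T : nat) (p : nat * 'I_T) :
    'rV[R]_2 -> 'rV[R]_2 := on_R2 (f_map (param d p)).

Definition calG (d : nat -> R) (T : nat) (p : nat * 'I_T) :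
    'rV[R]_2 -> 'rV[R]_2 := on_R2 (g_map (param d p)).

Definition JF (d : nat -> R) (T : nat) : set 'rV[R]_2 :=
  limit_set closed_disc (@calF d T).

Definition JG (d : nat -> R) (T : nat) : set 'rV[R]_2 :=
  limit_set closed_disc (@calG d T).

End Systems.

(* Main.v *)
(* The real axis meets the limit set in points p_n close to 1/d_n, and the gap
   between consecutive ones is of order n^-(1+gamma); hence the lower box
   dimension is at least 1/(1+gamma).  On the other hand the contraction ratios
   are of order d_n^-2, so sum_n d_n^(-2 sigma) < 1 over a far enough tail for
   every sigma > 1/(2 gamma), which bounds the Hausdorff dimension by sigma.
   Since gamma > 1, 1/(2 gamma) < 1/(1+gamma).  For the packing dimension, a
   countable cover of the limit set by sets of finite packing premeasure has, by
   a Baire argument on infinite words, a member whose closure contains a copy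
   s_w(J) of the whole limit set; s_w is bi-Lipschitz, so that member already
   has the upper box dimension of J. *)
Require Import Defs.
From mathcomp Require Import ring lra finmap.

Set Implicit Arguments.
Unset Strict Implicit.
Unset Printing Implicit Defensive.

Import Order.TTheory GRing.Theory Num.Theory.
Local Open Scope classical_set_scope.
Local Open Scope ring_scope.

(** * Euclidean norm and box dimensions *)

(** Both families can be treated at once because f_alpha and g_alpha map the closed disc onto the
    same round disc, which for real alpha = D >= 2 has real diameter [1/(D+1), 1/(D-1)]; only the
    distortion inside differs, and for both it lies between (D+1)^-2 and 4/D^2. The lower box bound
    needs no explicit limit point: the images of one arbitrary limit point under the maps with j = 0
    have real parts in these intervals. Consecutive intervals are disjoint only when d_(n+1) - d_n
    exceeds 2, so gamma > 1 enters here as well, by making the gaps tend to infinity. A large l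
    serves three ends: 4/D^2 becomes a uniform contraction ratio, the gap estimate holds from the
    first term on, and the sum of the ratios to the power sigma falls below 1 although T maps share
    each modulus. *)

Section EuclideanNorm.
Variables (R : realType) (d : nat).
Implicit Types u v w x : 'rV[R]_d.

Lemma edot_ge0 u : 0 <= edot u u.
Proof. by apply: sumr_ge0 => k _; rewrite -expr2 sqr_ge0. Qed.

Lemma edotC u v : edot u v = edot v u.
Proof. by apply: eq_bigr => k _; rewrite mulrC. Qed.

Lemma edotDl u v w : edot (u + v) w = edot u w + edot v w.
Proof. by rewrite -big_split; apply: eq_bigr => k _; rewrite !mxE mulrDl. Qed.

Lemma edotZl a u v : edot (a *: u) v = a * edot u v.
Proof. by rewrite mulr_sumr; apply: eq_bigr => k _; rewrite !mxE mulrA. Qed.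

Lemma enorm_ge0 u : 0 <= enorm u.
Proof. exact: sqrtr_ge0. Qed.

Lemma sqr_enorm u : enorm u ^+ 2 = edot u u.
Proof. by rewrite sqr_sqrtr // edot_ge0. Qed.

Lemma edot_le_enormM u v : edot u v <= enorm u * enorm v.
Proof.
have [a0|a_gt0] := leP (edot u v) 0.
  by rewrite (le_trans a0)// mulr_ge0 ?enorm_ge0.
rewrite -ler_sqr ?nnegrE ?mulr_ge0 ?enorm_ge0 //; last exact: ltW.
rewrite exprMn !sqr_enorm.
have [v0|v0] := eqVneq (edot v v) 0.
  (* If v.v = 0 while u.v > 0, this c would give u - c v the square norm -1. *)
  pose c := (edot u u + 1) / (2 * edot u v).
  have := edot_ge0 (u + (- c) *: v).
  rewrite !(edotDl, edotZl) !(edotC _ (_ + _)) !(edotDl, edotZl) v0 (edotC v u).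
  have : c * (2 * edot u v) = edot u u + 1 by rewrite divfK // gt_eqF // mulr_gt0.
  lra.
have := edot_ge0 ((edot v v) *: u + (- edot u v) *: v).
rewrite !(edotDl, edotZl) !(edotC _ (_ + _)) !(edotDl, edotZl) (edotC v u).
have v_gt0 : 0 < edot v v by rewrite lt_neqAle eq_sym v0 edot_ge0.
rewrite [leRHS](_ : _ = edot v v * (edot u u * edot v v - edot u v ^+ 2));
  last by ring.
by rewrite pmulr_rge0 // subr_ge0.
Qed.

Lemma enormD u v : enorm (u + v) <= enorm u + enorm v.
Proof.
rewrite -ler_sqr ?nnegrE ?addr_ge0 ?enorm_ge0 // sqrrD !sqr_enorm.
rewrite edotDl (edotC _ (u + v)) (edotC v (u + v)) !edotDl (edotC v u).
by have := edot_le_enormM u v; lra.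
Qed.

Lemma enormN u : enorm (- u) = enorm u.
Proof. by congr Num.sqrt; apply: eq_bigr => k _; rewrite !mxE mulrNN. Qed.

Lemma enormB u v : enorm (u - v) = enorm (v - u).
Proof. by rewrite -enormN opprB. Qed.

Lemma enorm_triangle w u v : enorm (u - v) <= enorm (u - w) + enorm (w - v).
Proof. by rewrite (le_trans _ (enormD _ _))// addrA subrK. Qed.

Lemma enorm0 : enorm (0 : 'rV[R]_d) = 0.
Proof. by rewrite /enorm /edot big1 ?sqrtr0// => k _; rewrite mxE mul0r. Qed.

Lemma ler_coord_enorm u k : `|u ord0 k| <= enorm u.
Proof.
rewrite -ler_sqr ?nnegrE ?enorm_ge0 // sqr_enorm real_normK ?num_real //.
rewrite /edot (bigD1 k) //= -expr2 lerDl.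
by apply: sumr_ge0 => j _; rewrite -expr2 sqr_ge0.
Qed.

Lemma ler_norm_enorm u : `|u| <= enorm u.
Proof.
rewrite /Num.norm /= mx_normrE.
apply: bigmax_le => [|[i j] _]; first exact: enorm_ge0.
by rewrite ord1 /=; exact: ler_coord_enorm.
Qed.

Lemma ler_enorm_norm u : enorm u <= d%:R * `|u|.
Proof.
have coord k : `|u ord0 k| <= `|u|.
  rewrite /Num.norm /= mx_normrE.
  exact: (le_bigmax _ (fun ij : 'I_1 * 'I_d => `|u ij.1 ij.2|) (ord0, k)).
rewrite -ler_sqr ?nnegrE ?mulr_ge0 ?enorm_ge0 // sqr_enorm.
apply: (@le_trans _ _ (\sum_(k < d) `|u| ^+ 2)).
  apply: ler_sum => k _; rewrite -expr2 -(@real_normK _ (u _ _)) ?num_real //.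
  by rewrite ler_sqr ?nnegrE.
rewrite sumr_const card_ord exprMn -[leLHS]mulr_natl ler_wpM2r ?sqr_ge0 //.
by rewrite -natrX ler_nat; case: (d) => // m; rewrite leq_pmulr.
Qed.

(** The topology comes from the sup norm while the Lipschitz bounds are Euclidean; this transfer is
    what makes the images of X under words compact. *)
Lemma lipschitz_within_continuous (X : set 'rV[R]_d)
    (f : 'rV[R]_d -> 'rV[R]_d) (c : R) :
  (forall x y, X x -> X y -> enorm (f x - f y) <= c * enorm (x - y)) ->
  {within X, continuous f}.
Proof.
move=> lipf; apply/subspace_continuousP => x Xx.
apply/cvgrPdist_lt => e e0.
(* The factor d compares the norms; the absolute value and the added 1 keep the constant positive
   whatever c and d are. *)
have c0 : 0 < `|c| * d%:R + 1 by rewrite ltr_wpDl // mulr_ge0.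
near=> y.
have Xy : X y by near: y; exact: withinT.
rewrite (le_lt_trans (ler_norm_enorm _)) // (le_lt_trans (lipf _ _ Xx Xy)) //.
rewrite (@le_lt_trans _ _ ((`|c| * d%:R + 1) * `|x - y|)) //.
  rewrite (@le_trans _ _ (`|c| * enorm (x - y))) //.
    by rewrite ler_wpM2r ?enorm_ge0 ?ler_norm.
  rewrite mulrDl mul1r (@le_trans _ _ (`|c| * d%:R * `|x - y|)) ?lerDl //.
  by rewrite -mulrA ler_wpM2l ?ler_enorm_norm.
rewrite mulrC -ltr_pdivlMr //.
near: y; apply: (@cvg_within _ (nbhs x) _ X).
have /cvgrPdist_lt : (id y @[y --> x] --> x) by exact: cvg_id.
by apply; rewrite divr_gt0.
Unshelve. all: by end_near. Qed.

Lemma ediam_ge0 (U : set 'rV[R]_d) : (0 <= ediam U)%E.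
Proof. by apply: ereal_sup_ubound; left. Qed.

Lemma ediam_leP (U : set 'rV[R]_d) (r : R) : 0 <= r ->
  (ediam U <= r%:E)%E <-> (forall x y, U x -> U y -> enorm (x - y) <= r).
Proof.
move=> r0; split=> [Ur x y Ux Uy|Ur].
  rewrite -lee_fin (le_trans _ Ur) //; apply: ereal_sup_ubound; right.
  by exists x, y.
apply: ge_ereal_sup => _ [->|[x [y [Ux [Uy ->]]]]]; rewrite lee_fin //.
exact: Ur.
Qed.

End EuclideanNorm.

(** * Limits superior and inferior along a filter *)

Section LimfNear.
Variables (T : choiceType) (X : filteredType T) (R : realType).
Variables (f : X -> \bar R) (F : set_system X) (a : \bar R).
Hypothesis FF : ProperFilter F.
Local Open Scope ereal_scope.

Lemma limf_esup_le_near : (\forall x \near F, f x <= a) -> limf_esup f F <= a.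
Proof.
move=> fa; rewrite limf_esupE.
apply: (@le_trans _ _ (ereal_sup (f @` [set x | f x <= a]))).
  by apply: ereal_inf_lbound; exists [set x | f x <= a].
by apply: ge_ereal_sup => _ [x fx <-].
Qed.

Lemma limf_esup_lt_near : limf_esup f F < a -> \forall x \near F, f x < a.
Proof.
rewrite limf_esupE => /ereal_inf_lt[_ [A FA <-] supa].
apply: filterS FA => x Ax; apply: le_lt_trans supa.
by apply: ereal_sup_ubound; exists x.
Qed.

Lemma limf_einf_ge_near : (\forall x \near F, a <= f x) -> a <= limf_einf f F.
Proof.
move=> fa; rewrite limf_einfE.
apply: (@le_trans _ _ (ereal_inf (f @` [set x | a <= f x]))).
  by apply: le_ereal_inf_tmp => _ [x fx <-].
by apply: ereal_sup_ubound; exists [set x | a <= f x].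
Qed.

Lemma limf_einf_le_esup : limf_einf f F <= limf_esup f F.
Proof.
rewrite limf_einfE limf_esupE.
apply: ge_ereal_sup => _ [A FA <-]; apply: le_ereal_inf_tmp => _ [B FB <-].
have [x [Ax Bx]] := filter_ex (filterI FA FB).
apply: (@le_trans _ _ (f x)).
  by apply: ereal_inf_lbound; exists x.
by apply: ereal_sup_ubound; exists x.
Qed.

End LimfNear.

Section BoxDimension.
Variables (R : realType) (d : nat).
Implicit Types (F U : set 'rV[R]_d) (t delta : R).

Lemma near0_powR_le (c e : R) : 0 < c -> 0 < e ->
  \forall x \near (0 : R)^'+, x `^ e <= c.
Proof.
move=> c0 e0; have /cvgrPdist_lt /(_ _ c0) := powR_cvg0 e0.
apply: filterS => x; rewrite sub0r normrN ger0_norm ?powR_ge0 //; exact: ltW.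
Qed.

Lemma covering_number_le F delta (n : nat) (U : 'I_n -> set 'rV[R]_d) :
  F `<=` \bigcup_k U k -> (forall k, (ediam (U k) <= delta%:E)%E) ->
  (covering_number F delta <= (n%:R)%:E)%E.
Proof. by move=> FU Ud; apply: ereal_inf_lbound; exists n, U. Qed.

(** A set of diameter at most delta holds at most one of the points, so sending each point to a
    covering set containing it is injective. *)
Lemma covering_number_ge F delta (A : finType) (p : A -> 'rV[R]_d) :
  0 <= delta -> (forall a, F (p a)) ->
  (forall a b, a != b -> delta < enorm (p a - p b)) ->
  ((#|A|%:R)%:E <= covering_number F delta)%E.
Proof.
move=> d0 Fp sep; apply: le_ereal_inf_tmp => _ [n [U [FU [Ud ->]]]].
rewrite lee_fin ler_nat.
have /choice[k Uk] : forall a, exists k, U k (p a).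
  by move=> a; have [k _ Uk] := FU _ (Fp a); exists k.
suff kinj : injective k by rewrite -(card_ord n); exact: leq_card kinj.
move=> a b kab; apply/eqP; apply/negPn/negP => /sep; rewrite ltNge => /negP; apply.
have /ediam_leP := Ud (k a) => /(_ d0); apply; first exact: Uk.
by rewrite kab; exact: Uk.
Qed.

Lemma covering_number_ge1 F delta : 0 <= delta -> F !=set0 ->
  (1 <= covering_number F delta)%E.
Proof.
move=> d0 [x Fx].
have := @covering_number_ge F delta unit (fun=> x) d0 (fun=> Fx).
by rewrite card_unit; apply => -[] [].
Qed.

Lemma near0_lt1 : \forall x \near (0 : R)^'+, 0 < x < 1.
Proof.
near=> x; apply/andP; split; near: x; first exact: nbhs_right_gt.
exact: nbhs_right_lt.
Unshelve. all: by end_near. Qed.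

(** For x < 1 the divisor -ln x is positive, so x^-t <= N and t <= ln N / (-ln x) are the same
    inequality; the upper bounds below rest on the same equivalence. *)
Lemma lower_box_dim_ge F t :
  (\forall x \near (0 : R)^'+, ((x `^ (- t))%:E <= covering_number F x)%E) ->
  (t%:E <= lower_box_dim F)%E.
Proof.
move=> Ft; apply: limf_einf_ge_near.
near=> x.
have /andP[x0 x1] : 0 < x < 1 by near: x; exact: near0_lt1.
have lnx : 0 < - ln x by rewrite oppr_gt0 ln_lt0 // x0.
have : ((x `^ (- t))%:E <= covering_number F x)%E by near: x.
rewrite /box_ratio => Nx.
rewrite lee_pdivlMr // -EFinM mulrN -mulNr -ln_powR.
rewrite -lne_EFin ?powR_gt0 // lee_lne // in_itv /= leey andbT.
  by rewrite lee_fin powR_ge0.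
by rewrite (le_trans _ Nx) // lee_fin powR_ge0.
Unshelve. all: by end_near. Qed.

Lemma upper_box_dim_le F t : F !=set0 ->
  (\forall x \near (0 : R)^'+, (covering_number F x <= (x `^ (- t))%:E)%E) ->
  (upper_box_dim F <= t%:E)%E.
Proof.
move=> F0 Ft; apply: limf_esup_le_near.
near=> x.
have /andP[x0 x1] : 0 < x < 1 by near: x; exact: near0_lt1.
have lnx : 0 < - ln x by rewrite oppr_gt0 ln_lt0 // x0.
have Nx : (covering_number F x <= (x `^ (- t))%:E)%E by near: x.
have N1 := covering_number_ge1 (ltW x0) F0.
rewrite /box_ratio lee_pdivrMr // -EFinM mulrN -mulNr -ln_powR.
rewrite -lne_EFin ?powR_gt0 // lee_lne // in_itv /= leey andbT.
  by rewrite (le_trans _ N1).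
by rewrite lee_fin powR_ge0.
Unshelve. all: by end_near. Qed.

Lemma upper_box_dim_lt F t : F !=set0 -> (upper_box_dim F < t%:E)%E ->
  \forall x \near (0 : R)^'+, (covering_number F x <= (x `^ (- t))%:E)%E.
Proof.
move=> F0 /limf_esup_lt_near Ft.
near=> x.
have /andP[x0 x1] : 0 < x < 1 by near: x; exact: near0_lt1.
have lnx : 0 < - ln x by rewrite oppr_gt0 ln_lt0 // x0.
have N1 := covering_number_ge1 (ltW x0) F0.
have : (box_ratio F x < t%:E)%E by near: x.
move=> /ltW; rewrite /box_ratio lee_pdivrMr // -EFinM mulrN -mulNr -ln_powR.
rewrite -lne_EFin ?powR_gt0 // lee_lne // in_itv /= leey andbT.
  by rewrite (le_trans _ N1).
by rewrite lee_fin powR_ge0.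
Unshelve. all: by end_near. Qed.

Lemma upper_box_dim_ge0 F : F !=set0 -> (0 <= upper_box_dim F)%E.
Proof.
move=> F0; apply: le_trans (limf_einf_le_esup _ _).
apply: (lower_box_dim_ge (t := 0)); near=> x.
rewrite oppr0 powRr0; apply: covering_number_ge1 => //.
Unshelve. all: by end_near. Qed.

Lemma lower_box_dim_le_upper F : (lower_box_dim F <= upper_box_dim F)%E.
Proof. exact: limf_einf_le_esup. Qed.

End BoxDimension.

(** * Packing dimension is at most upper box dimension *)

Section Sums.
Variable R : realType.

(** Serves both the geometric series over dyadic scales and the power series over the d_n. *)
Lemma esum_telescope_le (a b : nat -> R) (m : nat) :
  (forall j, (m <= j)%N -> 0 <= a j <= b j - b j.+1) ->
  (forall j, (m <= j)%N -> 0 <= b j) ->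
  (\esum_(j in [set j | (m <= j)%N]) (a j)%:E <= (b m)%:E)%E.
Proof.
move=> ab b0; rewrite -(nneseries_esum (P := fun j => (m <= j)%N)); last first.
  by move=> j /ab /andP[]; rewrite lee_fin.
apply: lime_le.
  by apply: is_cvg_nneseries_cond => j _ /ab /andP[]; rewrite lee_fin.
apply: nearW => n; rewrite sumEFin lee_fin.
(* The maximum covers n < m, where the partial sum is still empty. *)
suff : \sum_(0 <= j < n | (m <= j)%N) a j <= b m - b (maxn m n).
  by move=> /le_trans; apply; rewrite gerBl b0 // leq_maxl.
elim: n => [|n IH]; first by rewrite big_nil maxn0 subrr.
rewrite big_mkcond big_nat_recr //= -big_mkcond /=.
case: ifPn => [mn|]; last first.
  rewrite -ltnNge => nm; rewrite addr0 (le_trans IH) //.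
  by rewrite (maxn_idPl nm) (maxn_idPl (ltnW nm)).
have /andP[_ abn] := ab _ mn.
rewrite (maxn_idPr (leqW mn)); rewrite (maxn_idPr mn) in IH.
lra.
Qed.

Lemma esum_geometric_le (C x : R) (m : nat) : 0 <= C -> 0 < x < 1 ->
  (\esum_(j in [set j | (m <= j)%N]) (C * x ^+ j)%:E
     <= (C / (1 - x) * x ^+ m)%:E)%E.
Proof.
move=> C0 /andP[x0 x1]; have x1' : 0 < 1 - x by rewrite subr_gt0.
apply: (@esum_telescope_le _ (fun j => C / (1 - x) * x ^+ j)) => j _; last first.
  by rewrite mulr_ge0 ?exprn_ge0 ?divr_ge0 // ltW.
rewrite mulr_ge0 ?exprn_ge0 ?(ltW x0) //= exprS le_eqVlt.
by apply/orP; left; apply/eqP; field; rewrite gt_eqF.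
Qed.

End Sums.

Section Packing.
Variables (R : realType) (d : nat).
Implicit Types (F : set 'rV[R]_d) (s delta : R).

Lemma esum_separated_le F (D : set nat) (p : nat -> 'rV[R]_d) (delta c M : R) :
  0 <= delta -> 0 <= c -> (forall k, D k -> F (p k)) ->
  (forall k l, D k -> D l -> k <> l -> delta < enorm (p k - p l)) ->
  (covering_number F delta <= M%:E)%E ->
  (\esum_(k in D) c%:E <= (c * M)%:E)%E.
Proof.
move=> d0 c0 Fp sep NM; apply: ge_ereal_sup => _ [A [finA AD] <-].
rewrite fsbig_finite //= sumEFin lee_fin big_const_seq count_predT iter_addr_0.
rewrite -mulr_natr ler_wpM2l // -lee_fin (le_trans _ NM) //.
have inD (k : fset_set A) : D (val k).
  by apply: AD; have := valP k; rewrite /= in_fset_set // => /set_mem.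
have := @covering_number_ge _ _ F delta (fset_set A) (p \o val) d0.
rewrite -cardfE => -> // => [k|k l kl]; first exact/Fp/inD.
by apply: sep; [exact: inD|exact: inD|move=> /val_inj kl'; rewrite kl' eqxx in kl].
Qed.

Lemma dyadic_radius (m : nat) (r : R) : 0 < r <= (2^-1) ^+ m ->
  exists2 j, (m <= j)%N & (2^-1) ^+ j.+1 < r <= (2^-1) ^+ j.
Proof.
move=> /andP[r0 rm].
have [j0 j0r] : exists j, (2^-1 : R) ^+ j.+1 < r.
  have : (fun n => (2^-1 : R) ^+ n) @ \oo --> 0.
    by apply: cvg_expr; rewrite ger0_norm ?invr_ge0 // invf_lt1 ?ltr1n.
  move=> /cvgrPdist_lt/(_ _ r0)[j _ /(_ j.+1)] /=.
  rewrite leqnSn sub0r normrN ger0_norm ?exprn_ge0 ?invr_ge0 // => /(_ isT) jr.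
  by exists j.
have exj : exists j, (2^-1 : R) ^+ j.+1 < r by exists j0.
case: (ex_minnP exj) => j jr jmin.
have rj : r <= (2^-1) ^+ j.
  case: j jr jmin => [|j] jr jmin.
    by rewrite (le_trans rm) // exprn_ile1 ?invr_ge0 // invf_le1 ?ler1n.
  by rewrite leNgt; apply/negP => /jmin; rewrite ltnn.
exists j; last by rewrite jr.
have := lt_le_trans jr rm.
by rewrite ltr_iXn2l ?invr_gt0 ?invf_lt1 ?ltr1n.
Qed.

(** Sort the balls by the dyadic size of their radii. In the class of radii between 2^-(j+1) and
    2^-j the centres are more than 2^-(j+1) apart, so there are at most 2^((j+1)t) of them, each of
    weight at most (2 * 2^-j)^s. The classes j >= m then form a geometric series of ratio
    2^-(s-t). *)
Lemma packing_premeasure_at_le F (s t : R) (m : nat) : 0 < t < s ->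
  (forall j, (m <= j)%N ->
    (covering_number F ((2^-1) ^+ j.+1) <= (((2^-1) ^+ j.+1) `^ (- t))%:E)%E) ->
  (packing_premeasure_at s ((2^-1) ^+ m) F
     <= (2 `^ (s + t) / (1 - 2^-1 `^ (s - t)) * (2^-1 `^ (s - t)) ^+ m)%:E)%E.
Proof.
move=> /andP[t0 ts] NF; set x : R := 2^-1 `^ (s - t).
have h0 : 0 < 2^-1 :> R by rewrite invr_gt0.
have x01 : 0 < x < 1.
  rewrite powR_gt0 //=.
  have := @gt0_ltr_powR _ (s - t) _ 2^-1 1.
  by rewrite powR1; apply; rewrite ?subr_gt0 ?nnegrE ?invf_lt1 ?ltr1n // ltW.
apply: ge_ereal_sup => _ [D [c [r [Dr [disj ->]]]]].
pose Dj j := [set k | D k /\ (2^-1) ^+ j.+1 < r k <= (2^-1) ^+ j].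
have trivD : trivIset [set: nat] Dj.
  have aux j j' k : (j < j')%N -> Dj j k -> ~ Dj j' k.
    move=> jj' [_ /andP[jr _]] [_ /andP[_ rj']].
    have := lt_le_trans jr rj'.
    by rewrite ltr_iXn2l ?invf_lt1 ?ltr1n // ltnNge jj'.
  move=> j j' _ _ [k [kj kj']]; case: (ltngtP j j') => // jj'.
    by case: (aux _ _ _ jj' kj kj').
  by case: (aux _ _ _ jj' kj' kj).
have -> : D = \bigcup_(j in [set j | (m <= j)%N]) Dj j.
  apply/seteqP; split=> [k Dk|k [j _ []]//].
  by have [_ /dyadic_radius[j mj rj]] := Dr _ Dk; exists j.
rewrite esum_bigcupT //; last by move=> k; rewrite lee_fin powR_ge0.
apply: le_trans (esum_geometric_le m (powR_ge0 _ _) x01).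
apply: le_esum => j mj.
pose y : R := (2^-1) ^+ j; have y0 : 0 < y by rewrite exprn_gt0.
have -> : 2 `^ (s + t) * x ^+ j = (2 * y) `^ s * ((2^-1) ^+ j.+1) `^ (- t).
  have -> : x ^+ j = y `^ s * y `^ (- t).
    rewrite -powRD ?(gt_eqF y0) ?implybT // -powR_mulrn ?powR_ge0 // powRAC.
    by rewrite powR_mulrn // ltW.
  have -> : 2 `^ (s + t) = 2 `^ s * 2^-1 `^ (- t) :> R.
    by rewrite -powR_inv1 // -powRrM mulrNN mul1r powRD // pnatr_eq0 implybT.
  by rewrite exprS -/y !powRM ?invr_ge0 ?(ltW y0) //; ring.
apply: (@le_trans _ _ (\esum_(k in Dj j) ((2 * y) `^ s)%:E)).
  apply: le_esum => k [Dk /andP[_ rk]]; rewrite lee_fin ge0_ler_powR ?nnegrE //.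
  - by rewrite (le_trans (ltW t0)) // ltW.
  - by have [_ /andP[/ltW rk0 _]] := Dr _ Dk; rewrite mulr_ge0.
  - by rewrite mulr_ge0 // ltW.
  - by rewrite ler_pM2l.
apply: (@esum_separated_le F (Dj j) c _ _ _ _ (powR_ge0 _ _) _ _ (NF _ mj)).
- by rewrite exprn_ge0.
- by move=> k [/Dr[]].
move=> k l [Dk /andP[rk _]] [Dl /andP[rl _]] kl.
rewrite (lt_le_trans rk) // leNgt; apply/negP => ckl.
(* Centres closer than the radius of ball k would put [c l] in both balls. *)
apply: kl; apply: (disj k l Dk Dl); exists (c l); split; rewrite /ecball /=.
  by rewrite enormB ltW.
by rewrite subrr enorm0; have [_ /andP[/ltW]] := Dr _ Dl.
Qed.

Lemma packing_premeasure_at_ge0 s delta F : (0 <= packing_premeasure_at s delta F)%E.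
Proof.
apply: ereal_sup_ubound; exists set0, (fun=> 0), (fun=> 0); rewrite esum_set0.
by do !split=> //; move=> ? ? [].
Qed.

Lemma packing_premeasure_ge0 s F : (0 <= packing_premeasure s F)%E.
Proof.
by apply: le_ereal_inf_tmp => _ [delta _ <-]; exact: packing_premeasure_at_ge0.
Qed.

Lemma packing_premeasure0 s : packing_premeasure s (set0 : set 'rV[R]_d) = 0%E.
Proof.
apply/eqP; rewrite eq_le packing_premeasure_ge0 andbT.
apply: (@le_trans _ _ (packing_premeasure_at s 1 set0)).
  by apply: ereal_inf_lbound; exists 1 => //=.
apply: ge_ereal_sup => _ [D [c [r [Dr [_ ->]]]]].
by rewrite (_ : D = set0) ?esum_set0 // -subset0 => k /Dr[].
Qed.

Lemma packing_measure_le s F : (packing_measure s F <= packing_premeasure s F)%E.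
Proof.
apply: ereal_inf_lbound; exists (fun k => if k == 0%N then F else set0); split.
  by move=> x Fx; exists 0%N.
rewrite nneseries_recl //; last by move=> k _; exact: packing_premeasure_ge0.
rewrite eseries0 ?adde0 // => -[|k] //= _ _; exact: packing_premeasure0.
Qed.

Lemma packing_measure_ge0 s F : (0 <= packing_measure s F)%E.
Proof.
apply: le_ereal_inf_tmp => _ [A [_ ->]]; apply: nneseries_ge0 => k _ _.
exact: packing_premeasure_ge0.
Qed.

Lemma packing_dim_le_upper_box F : F !=set0 ->
  (packing_dim F <= upper_box_dim F)%E.
Proof.
move=> F0.
suff suff_s (s : R) : (upper_box_dim F < s%:E)%E -> (packing_dim F <= s%:E)%E.
  have := upper_box_dim_ge0 F0.
  case E : (upper_box_dim F) => [u| |] // u0; last exact: leey.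
  apply/lee_addgt0Pr => e e0; apply: suff_s.
  by rewrite E lte_fin ltrDl.
move=> us; have s0 : 0 < s.
  by rewrite -lte_fin (le_lt_trans (upper_box_dim_ge0 F0)).
(* The room between t and s is what makes the geometric ratio x smaller than 1. *)
have [t t0s ut] : exists2 t, 0 < t < s & (upper_box_dim F < t%:E)%E.
  have := upper_box_dim_ge0 F0.
  case: (upper_box_dim F) us => [u| |] // us u0; rewrite lte_fin in us.
  have [us1 us2] := midf_lt us; rewrite lee_fin in u0.
  exists ((u + s) / 2); last by rewrite lte_fin.
  by rewrite us2 (le_lt_trans u0).
apply: ereal_inf_lbound; exists s => //; split; first exact: ltW.
apply/eqP; rewrite eq_le packing_measure_ge0 andbT.
apply: le_trans (packing_measure_le _ _) _.
set x : R := 2^-1 `^ (s - t).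
have cvg0 (y : R) : 0 < y < 1 -> (fun n => y ^+ n) @ \oo --> 0.
  by move=> /andP[y0 y1]; apply: cvg_expr; rewrite ger0_norm // ltW.
have x01 : 0 < x < 1.
  have /andP[_ ts] := t0s.
  rewrite powR_gt0 ?invr_gt0 //=.
  have := @gt0_ltr_powR _ (s - t) _ 2^-1 1.
  by rewrite powR1; apply; rewrite ?subr_gt0 ?nnegrE ?invf_lt1 ?ltr1n.
apply/lee_addgt0Pr => e e0; rewrite add0e.
have := upper_box_dim_lt F0 ut; rewrite near_withinE => -[/= eta eta0 Nt].
have h01 : 0 < (2^-1 : R) < 1 by rewrite invr_gt0 invf_lt1 ?ltr1n // ltr0n.
have [m1 _ m1P] := (@cvgrPdist_lt _ _ _ _ _ _ _).1 (cvg0 _ h01) _ eta0.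
pose C := 2 `^ (s + t) / (1 - x).
have C0 : 0 < C.
  by rewrite divr_gt0 ?powR_gt0 // subr_gt0; case/andP: x01.
have [m2 _ m2P] := (@cvgrPdist_lt _ _ _ _ _ _ _).1 (cvg0 _ x01) _ (divr_gt0 e0 C0).
(* From m1 on the scales are small enough for the covering bound with exponent t; from m2 on the
   geometric tail is below e. *)
pose m := maxn m1 m2.
apply: (@le_trans _ _ (packing_premeasure_at s ((2^-1) ^+ m) F)).
  by apply: ereal_inf_lbound; exists ((2^-1) ^+ m) => //=.
apply: (le_trans (packing_premeasure_at_le t0s _)) => [j mj|].
  apply: Nt; last by rewrite /= exprn_gt0 // invr_gt0.
  apply: m1P => /=; rewrite (leq_trans _ (leqnSn _)) // (leq_trans _ mj) //.
  exact: leq_maxl.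
rewrite -/x -/C lee_fin mulrC -ler_pdivlMr //.
have := m2P m (leq_maxr _ _); rewrite sub0r normrN => /ltW /=; apply: le_trans.
exact: ler_norm.
Qed.

End Packing.

(** * Limit sets of bi-Lipschitz systems *)

Section Hausdorff.
Variables (R : realType) (d : nat).
Implicit Types (F : set 'rV[R]_d) (s delta : R).

Lemma gauge_ge0 s (U : set 'rV[R]_d) : (0 <= gauge s U)%E.
Proof. by rewrite /gauge; case: ifP => // _; exact: poweR_ge0. Qed.

(** Allows covers indexed by words. Naturals that code no index receive the empty set, whose gauge
    is 0 even for s = 0. *)
Lemma hausdorff_premeasure_le (A : countType) (V : A -> set 'rV[R]_d) F s delta :
  0 <= delta -> F `<=` \bigcup_a V a ->
  (forall a, (ediam (V a) <= delta%:E)%E) ->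
  (hausdorff_premeasure s delta F <= \esum_(a in [set: A]) gauge s (V a))%E.
Proof.
move=> d0 FV Vd.
pose U (k : nat) : set 'rV[R]_d :=
  if @choice.pickle_inv A k is Some a then V a else set0.
have UE a : U (choice.pickle a) = V a by rewrite /U pickleK_inv.
apply: (@le_trans _ _ (\sum_(0 <= k <oo) gauge s (U k))%E).
  apply: ereal_inf_lbound; exists U; split; first last.
    split=> // k; rewrite /U; case: choice.pickle_inv => //.
    by apply/ediam_leP => // x y [].
  by move=> x /FV[a _ Vx]; exists (choice.pickle a); rewrite ?UE.
rewrite nneseries_esumT; last by move=> k; exact: gauge_ge0.
under [leRHS]eq_esum do rewrite -UE.
rewrite [leRHS](_ : _ = \esum_(k in range (@choice.pickle A)) gauge s (U k))%E;
  last first.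
  by rewrite esum_image // => a b _ _ /(pcan_inj pickleK_inv).
rewrite [leRHS]esum_mkcond. apply: le_esum => k _.
case: ifPn => // /negP kP; rewrite /= /U /gauge.
case E : choice.pickle_inv => [a|]; last by rewrite eqxx.
have /= := @choice.pickle_invK A k; rewrite E /= => ka.
by exfalso; apply: kP; apply/mem_set; exists a.
Qed.

Lemma hausdorff_premeasure_ge0 s delta F : (0 <= hausdorff_premeasure s delta F)%E.
Proof.
apply: le_ereal_inf_tmp => _ [U [_ [_ ->]]]; apply: nneseries_ge0 => k _ _.
exact: gauge_ge0.
Qed.

Lemma gauge_le s (U : set 'rV[R]_d) r : 0 <= s -> 0 <= r ->
  (ediam U <= r%:E)%E -> (gauge s U <= (r `^ s)%:E)%E.
Proof.
move=> s0 r0 Ur; rewrite /gauge; case: ifP => _; first by rewrite lee_fin powR_ge0.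
rewrite -poweR_EFin gt0_ler_poweR // in_itv /= leey andbT ?ediam_ge0 //.
Qed.

End Hausdorff.

(** * Sums over words of fixed length *)

Section TupleSums.
Variables (R : realType) (I : countType).

Lemma esumZ_le (A : choiceType) (D : set A) (f : A -> \bar R) (c M : R) :
  0 <= c -> (forall a, (0 <= f a)%E) -> (\esum_(a in D) f a <= M%:E)%E ->
  (\esum_(a in D) (c%:E * f a) <= (c * M)%:E)%E.
Proof.
move=> c0 f0 fM; apply: ge_ereal_sup => _ [B [finB BD] <-].
rewrite -ge0_mule_fsumr // EFinM lee_wpmul2l ?lee_fin // (le_trans _ fM) //.
by apply: ereal_sup_ubound; exists B.
Qed.

(** The n-th power of the sum over letters expands into the sum over words of length n; the
    induction splits off the first letter. *)
Lemma esum_tuple_prod (a : I -> R) (theta : R) n : (forall i, 0 <= a i) ->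
  (\esum_(i in [set: I]) (a i)%:E <= theta%:E)%E ->
  (\esum_(w in [set: n.-tuple I]) (\prod_(i <- w) a i)%:E <= (theta ^+ n)%:E)%E.
Proof.
move=> a0 atheta; elim: n => [|n IH].
  rewrite [X in esum X](_ : _ = [set [tuple]]); last first.
    by apply/seteqP; split=> // w _; exact: tuple0.
  by rewrite esum_set1 big_nil ?lee_fin.
rewrite (reindex_esum ([set: I] `*`` fun=> [set: n.-tuple I]) _
  (fun iw => [tuple of iw.1 :: iw.2])); last first.
  split=> // [[i w] [j v] _ _ /(congr1 val) /= [-> /val_inj ->] //|w _].
  by exists (thead w, [tuple of behead w]) => //=; rewrite -tuple_eta.
under eq_esum do rewrite big_cons.
rewrite -(esum_esum (a := fun i w => (a i * \prod_(j <- tval w) a j)%:E)); last first.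
  by move=> i w _ _; rewrite lee_fin mulr_ge0 // prodr_ge0.
apply: (@le_trans _ _ (\esum_(i in [set: I]) ((theta ^+ n)%:E * (a i)%:E))%E).
  apply: le_esum => i _; under eq_esum do rewrite EFinM.
  rewrite -EFinM mulrC; apply: esumZ_le => // w.
  by rewrite lee_fin prodr_ge0.
rewrite exprSr; apply: esumZ_le => //.
rewrite exprn_ge0 // -lee_fin (le_trans _ atheta) //; apply: esum_ge0 => i _.
by rewrite lee_fin.
Qed.

End TupleSums.

Section SeparatedSets.
Variables (R : realType) (d : nat).

(** Take a 2 eta-separated family in A of maximal size. The eta-balls around it are disjoint, so the
    packing bound caps its size and a maximum exists; a point of A farther than 2 eta from all
    centres could be added to it. *)
Lemma packing_premeasure_at_cover (A : set 'rV[R]_d) (s delta eta : R) :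
  0 < eta <= delta -> (packing_premeasure_at s delta A <= 1)%E ->
  exists n (c : nat -> 'rV[R]_d),
    [/\ forall i, (i < n)%N -> A (c i), n%:R * (2 * eta) `^ s <= 1 &
        forall a, A a -> exists2 i, (i < n)%N & enorm (a - c i) <= 2 * eta].
Proof.
move=> /andP[eta0 etad] Ps.
pose sep n (c : nat -> 'rV[R]_d) := (forall i, (i < n)%N -> A (c i)) /\
  forall i j, (i < j < n)%N -> 2 * eta < enorm (c i - c j).
have sepP n c : sep n c -> n%:R * (2 * eta) `^ s <= 1.
  move=> [Ac sepc].
  rewrite -lee_fin (le_trans _ Ps) //; apply: ereal_sup_ubound.
  exists [set` iota 0 n], c, (fun=> eta); split; [|split].
  - by move=> k /=; rewrite mem_iota => /Ac; rewrite eta0.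
  - have aux i j : (i < j < n)%N ->
        ecball (c i) eta `&` ecball (c j) eta !=set0 -> False.
      move=> /sepc; rewrite ltNge => /negP cij [y [yi yj]]; apply: cij.
      rewrite (le_trans (enorm_triangle y _ _)) // enormB.
      by rewrite mulr_natl mulr2n lerD.
    move=> i j /=; rewrite !mem_iota !add0n /= => ni nj cij.
    case: (ltngtP i j) => // ij; first by case: (@aux i j); rewrite ?ij.
    by case: (@aux j i); rewrite ?ij // setIC.
  rewrite esum_fset; [|exact: finite_seq|by move=> k _; rewrite lee_fin powR_ge0].
  rewrite -fsbig_seq ?iota_uniq // sumEFin big_const_seq count_predT size_iota.
  by rewrite iter_addr_0 mulr_natl.
have y0 : 0 < (2 * eta) `^ s by rewrite powR_gt0 // mulr_gt0.
have ex0 : exists n, `[< exists c, sep n c >].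
  by exists 0%N; apply/asboolP; exists (fun=> 0); split=> // i j; rewrite ltn0 andbF.
have ub : forall n, `[< exists c, sep n c >] ->
    (n <= Num.truncn ((2 * eta) `^ s)^-1)%N.
  move=> n /asboolP[c /sepP]; rewrite -ler_pdivlMr // div1r => nle.
  by rewrite -(natrK (R := R) n) le_truncn.
case: (ex_maxnP ex0 ub) => n /asboolP[c sepc] nmax.
exists n, c; split; [by case: sepc|exact: sepP sepc|].
move=> a Aa; apply: contrapT => nocov.
have /nmax : `[< exists c, sep n.+1 c >]; last by rewrite ltnn.
have [Ac cc] := sepc.
apply/asboolP; exists (fun i => if i == n then a else c i); split.
  by move=> i; rewrite ltnS leq_eqVlt; case: eqP => //= _; exact: Ac.
move=> i j /andP[ij]; rewrite ltnS leq_eqVlt => jn.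
rewrite (ltn_eqF (leq_trans ij _)) //; last by case/orP: jn => [/eqP->|/ltnW].
move: jn; case: eqP => [jn _|_ /= jn]; last by apply: cc; rewrite ij.
rewrite ltNge; apply/negP => ca; apply: nocov; exists i; first by rewrite -jn.
by rewrite enormB.
Qed.

End SeparatedSets.

Section LimitSet.
Variables (R : realType) (d : nat) (I : countType) (i0 : I).
Variables (X : set 'rV[R]_d) (s : I -> 'rV[R]_d -> 'rV[R]_d).
Variables (lo up : I -> R) (kappa diam : R).
Hypotheses (cX : compact X) (X0 : X !=set0).
Hypothesis diamX : forall x y, X x -> X y -> enorm (x - y) <= diam.
Hypothesis sX : forall i x, X x -> X (s i x).
Hypothesis s_up : forall i x y, X x -> X y ->
  enorm (s i x - s i y) <= up i * enorm (x - y).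
Hypothesis s_lo : forall i x y, X x -> X y ->
  lo i * enorm (x - y) <= enorm (s i x - s i y).
Hypothesis lo_gt0 : forall i, 0 < lo i.
Hypothesis up_gt0 : forall i, 0 < up i.
Hypothesis up_le : forall i, up i <= kappa.
Hypothesis kappa_lt1 : kappa < 1.

Local Notation J := (limit_set X s).
Local Notation "s_[ w ]" := (word_map s w) (format "s_[ w ]").

Let kappa_gt0 : 0 < kappa.
Proof. exact: lt_le_trans (up_gt0 i0) (up_le i0). Qed.

Let diam_ge0 : 0 <= diam.
Proof.
by have [x Xx] := X0; apply: le_trans (diamX Xx Xx); exact: enorm_ge0.
Qed.

Lemma word_map_cat u v x : s_[u ++ v] x = s_[u] (s_[v] x).
Proof. by elim: u => //= i u ->. Qed.

Lemma word_mapX w x : X x -> X (s_[w] x).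
Proof. by elim: w => //= i w IH Xx; exact/sX/IH. Qed.

Lemma word_map_up w x y : X x -> X y ->
  enorm (s_[w] x - s_[w] y) <= \prod_(i <- w) up i * enorm (x - y).
Proof.
move=> Xx Xy; elim: w => [|i w IH]; first by rewrite big_nil mul1r.
rewrite big_cons /= (le_trans (s_up _ _ _)) //; try exact: word_mapX.
by rewrite -mulrA ler_wpM2l // ltW.
Qed.

Lemma word_map_lo w x y : X x -> X y ->
  \prod_(i <- w) lo i * enorm (x - y) <= enorm (s_[w] x - s_[w] y).
Proof.
move=> Xx Xy; elim: w => [|i w IH]; first by rewrite big_nil mul1r.
rewrite big_cons /= (le_trans _ (s_lo _ _ _)) //; try exact: word_mapX.
by rewrite -mulrA ler_wpM2l // ltW.
Qed.

Lemma prod_up_le w : 0 <= \prod_(i <- w) up i <= kappa ^+ size w.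
Proof.
elim: w => [|i w /andP[IH1 IH2]]; first by rewrite big_nil ler01 lexx.
rewrite big_cons exprS mulr_ge0 ?(ltW (up_gt0 _)) //=.
by rewrite ler_pM // ltW.
Qed.

Lemma ediam_word_map w (n : nat) : (n <= size w)%N ->
  (ediam (s_[w] @` X) <= (kappa ^+ n * diam)%:E)%E.
Proof.
move=> nw; apply/ediam_leP; first by rewrite mulr_ge0 // exprn_ge0 // ltW.
move=> _ _ [x Xx <-] [y Xy <-]; rewrite (le_trans (word_map_up _ _ _)) //.
have /andP[p0 p1] := prod_up_le w.
rewrite ler_pM ?enorm_ge0 ?diamX // (le_trans p1) //.
by rewrite ler_wiXn2l // ltW.
Qed.

Lemma small_kappa (e : R) : 0 < e -> exists n, kappa ^+ n * diam < e.
Proof.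
move=> e0; have d1 : 0 < diam + 1 by rewrite ltr_wpDl.
have : (fun n => kappa ^+ n) @ \oo --> 0.
  by apply: cvg_expr; rewrite ger0_norm // ltW.
move=> /cvgrPdist_lt/(_ _ (divr_gt0 e0 d1))[n _ /(_ n (leqnn _))] /=.
rewrite sub0r normrN ger0_norm ?exprn_ge0 ?(ltW kappa_gt0) // ltr_pdivlMr // => ne.
exists n; rewrite (le_lt_trans _ ne) // ler_wpM2l ?exprn_ge0 ?(ltW kappa_gt0) //.
by rewrite lerDl.
Qed.

Lemma word_map_compact w : compact (s_[w] @` X).
Proof.
apply: continuous_compact cX; apply: lipschitz_within_continuous => x y Xx Xy.
exact: word_map_up.
Qed.

Lemma mkseq_add (u : nat -> I) m n :
  mkseq u (m + n) = mkseq u m ++ mkseq (fun k => u (m + k)%N) n.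
Proof.
by rewrite /mkseq iotaD map_cat add0n -[X in iota X n]addn0 iotaDl -map_comp.
Qed.

(** The sets s_(u|n)(X) are nested and compact. The images of one base point are eventually in each
    of them, hence so is any cluster point. *)
Lemma limit_set_point (u : nat -> I) :
  exists x, forall n, (s_[mkseq u n] @` X) x.
Proof.
have [x0 Xx0] := X0.
pose y n := s_[mkseq u n] x0.
have yX n : X (y n) by exact: word_mapX.
have [|x [_ clx]] := cX (fmap_proper_filter y eventually_filter).
  by exists 0%N => // n _; exact: yX.
exists x => n.
have cn : closed (s_[mkseq u n] @` X).
  by apply: compact_closed; [exact: norm_hausdorff|exact: word_map_compact].
apply: cn => B Bx; apply: clx => //.
exists n => // m /= nm; rewrite /y -(subnKC nm) mkseq_add word_map_cat.
by eexists; last reflexivity; exact: word_mapX.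
Qed.

Lemma limit_set_sub x : J x -> X x.
Proof. by move=> [u /(_ 1%N isT)[y Xy <-]]; exact: word_mapX. Qed.

Lemma limit_set_nonempty : J !=set0.
Proof. by have [x Jx] := limit_set_point (fun=> i0); exists x, (fun=> i0). Qed.

Lemma limit_set_map i x : J x -> J (s i x).
Proof.
move=> Jx; have Xx := limit_set_sub Jx; have [u ux] := Jx.
pose v n := if n is m.+1 then u m else i.
exists v => -[//|n] _; rewrite -(add1n n) mkseq_add /=.
have [->|n0] := posnP n; first by exists x.
by have [y Xy <-] := ux n n0; exists y.
Qed.

Lemma limit_set_cover n x : J x ->
  exists2 w : n.-tuple I, True & (s_[w] @` X) x.
Proof.
case: n => [|n] Jx.
  by exists [tuple] => //; exists x => //; exact: limit_set_sub.
have [u /(_ n.+1 isT) ux] := Jx.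
by exists (Tuple (introT eqP (size_mkseq u n.+1))).
Qed.

Lemma powR_prod (w : seq I) (a : I -> R) (t : R) : (forall i, 0 <= a i) ->
  (\prod_(i <- w) a i) `^ t = \prod_(i <- w) a i `^ t.
Proof.
move=> a0; elim: w => [|i w IH]; first by rewrite !big_nil powR1.
by rewrite !big_cons powRM ?IH // prodr_ge0.
Qed.

(** The cylinders of length n cover J, have diameter at most kappa^n diam, and their diameters to
    the power t sum to at most diam^t theta^n, which tends to 0. *)
Lemma hausdorff_dim_limit_set_le (t theta : R) : 0 <= t -> theta < 1 ->
  (\esum_(i in [set: I]) (up i `^ t)%:E <= theta%:E)%E ->
  (hausdorff_dim J <= t%:E)%E.
Proof.
move=> t0 theta1 upt.
have theta0 : 0 <= theta.
  rewrite -lee_fin (le_trans _ upt) //; apply: esum_ge0 => i _.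
  by rewrite lee_fin powR_ge0.
apply: ereal_inf_lbound; exists t => //; split=> //.
apply/eqP; rewrite eq_le; apply/andP; split; last first.
  apply: (@le_trans _ _ (hausdorff_premeasure t 1 J)).
    exact: hausdorff_premeasure_ge0.
  by apply: ereal_sup_ubound; exists 1 => //=.
apply: ge_ereal_sup => _ [delta /= delta0 <-].
apply/lee_addgt0Pr => e e0; rewrite add0e.
have dt1 : 0 < diam `^ t + 1 by rewrite ltr_wpDl // powR_ge0.
have [n1 n1P] := small_kappa delta0.
have : (fun n => theta ^+ n) @ \oo --> 0.
  by apply: cvg_expr; rewrite ger0_norm.
move=> /cvgrPdist_lt/(_ _ (divr_gt0 e0 dt1))[n2 _ n2P].
pose n := maxn n1 n2.
have diamw (w : n.-tuple I) : (ediam (s_[w] @` X) <= delta%:E)%E.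
  apply: (le_trans (@ediam_word_map w n1 _)); last by rewrite lee_fin ltW.
  by rewrite size_tuple leq_maxl.
have Jcov : J `<=` \bigcup_(w : n.-tuple I) (s_[w] @` X).
  by move=> x /(limit_set_cover n)[w _ wx]; exists w.
apply: (le_trans (hausdorff_premeasure_le t (ltW delta0) Jcov diamw)).
apply: (@le_trans _ _ (\esum_(w in [set: n.-tuple I])
    ((diam `^ t)%:E * (\prod_(i <- w) up i `^ t)%:E))%E).
  apply: le_esum => w _.
  have pw : 0 <= \prod_(i <- w) up i by rewrite prodr_ge0 // => i _; exact: ltW.
  rewrite -EFinM -powR_prod; last by move=> i; exact: ltW.
  rewrite -powRM // mulrC; apply: gauge_le => //; first by rewrite mulr_ge0.
  apply/ediam_leP; first by rewrite mulr_ge0.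
  move=> _ _ [x Xx <-] [y Xy <-]; apply: le_trans (word_map_up _ Xx Xy) _.
  by rewrite ler_wpM2l // diamX.
apply: (@le_trans _ _ (diam `^ t * theta ^+ n)%:E).
  apply: esumZ_le; first exact: powR_ge0.
    by move=> w; rewrite lee_fin prodr_ge0 // => i _; exact: powR_ge0.
  by apply: esum_tuple_prod => // i; exact: powR_ge0.
have := n2P n (leq_maxr _ _).
rewrite /= sub0r normrN ger0_norm ?exprn_ge0 // ltr_pdivlMr // lee_fin => /ltW.
by apply: le_trans; rewrite mulrC ler_wpM2l ?exprn_ge0 // lerDl.
Qed.

(* The Baire category argument runs on the space of infinite words, since the
   limit set itself need not be closed. *)
Lemma limit_set_baire (A : nat -> set 'rV[R]_d) : J `<=` \bigcup_k A k ->
  exists (w : seq I) k, forall y, J y -> forall e, 0 < e ->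
    exists2 a, A k a & enorm (s_[w] y - a) < e.
Proof.
move=> JA; apply: contrapT => noA.
(* Otherwise some s_v(y) with y in J keeps a distance e from A k, and a long enough prefix of a
   coding of y gives a cylinder of diameter below e around it, disjoint from A k. *)
have ext v k : exists u, (0 < size u)%N /\ forall x, (s_[v ++ u] @` X) x -> ~ A k x.
  apply: contrapT => nou; apply: noA; exists v, k => y Jy e e0.
  apply: contrapT => nofa; apply: nou.
  have [n ne] := small_kappa e0.
  have [tau tauy] := Jy.
  exists (mkseq tau n.+1); rewrite size_mkseq; split=> // x [z Xz <-] Ax.
  apply: nofa; exists (s_[v ++ mkseq tau n.+1] z) => //.
  have [y' Xy' <-] := tauy n.+1 isT; rewrite -word_map_cat.
  rewrite (le_lt_trans _ ne) //.
  have nw : (n <= size (v ++ mkseq tau n.+1))%N.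
    by rewrite size_cat size_mkseq addnS ltnW // ltnS leq_addl.
  have /ediam_leP := ediam_word_map nw; apply.
  - by rewrite mulr_ge0 // exprn_ge0 // ltW.
  - by exists y'.
  - by exists z.
have /choice[U UP] : forall vk : seq I * nat, exists u, (0 < size u)%N /\
    forall x, (s_[vk.1 ++ u] @` X) x -> ~ A vk.2 x.
  by move=> [v k]; exact: ext.
(* Step m extends the word so that its cylinder avoids A m; the point coded by the limit word then
   lies in J but in no A k. *)
pose V := fix V k := if k is m.+1 then V m ++ U (V m, m) else [::].
have VS k : V k.+1 = V k ++ U (V k, k) by [].
have sizeV k : (k <= size (V k))%N.
  elim: k => // k IH; rewrite VS size_cat -addn1 leq_add //.
  by case: (UP (V k, k)).
have prefV k m : (k <= m)%N -> exists v, V m = V k ++ v.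
  move=> /subnKC <-; elim: (m - k)%N => [|j [v IH]].
    by exists [::]; rewrite addn0 cats0.
  by rewrite addnS VS IH -catA; eexists.
(* [V n.+1] has at least n+1 letters, so the default [i0] is never read. *)
pose om n := nth i0 (V n.+1) n.
have omV k : mkseq om (size (V k)) = V k.
  apply: (@eq_from_nth _ i0); rewrite size_mkseq // => n nk.
  rewrite nth_mkseq // /om; case: (leqP k n.+1) => [/prefV[v ->]|/ltnW/prefV[v ->]].
    by rewrite nth_cat nk.
  by rewrite nth_cat (sizeV n.+1).
have [x xom] := limit_set_point om.
have [|k _ Akx] := JA x; first by exists om.
have [_ /(_ x)] := UP (V k, k); rewrite /= -VS; apply => //.
by rewrite -[V k.+1]omV; exact: xom.
Qed.

(** A cover of A by balls of radius 2 eta is pulled back along s_w. Points of s_w(J) are within eta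
    of A, hence within 3 eta of a centre; two of them sharing a centre are at most 6 eta apart, and
    s_w shrinks distances at most by the product of the [lo i]. *)
Lemma covering_number_limit_set_le (w : seq I) (A : set 'rV[R]_d) (t delta eta : R) :
  (forall y, J y -> forall e, 0 < e ->
     exists2 a, A a & enorm (s_[w] y - a) < e) ->
  0 < eta <= delta -> (packing_premeasure_at t delta A <= 1)%E ->
  (covering_number J (6 * eta / \prod_(i <- w) lo i)
     <= ((2 * eta) `^ (- t))%:E)%E.
Proof.
move=> JA etad PA; have /andP[eta0 _] := etad.
have [n [c [_ nle cov]]] := packing_premeasure_at_cover etad PA.
have low : 0 < \prod_(i <- w) lo i by rewrite prodr_gt0.
pose U (k : 'I_n) := [set y | J y /\ enorm (s_[w] y - c k) <= 3 * eta].
apply: (@le_trans _ _ (n%:R)%:E).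
  apply: (@covering_number_le _ _ _ _ _ U) => [y Jy|k].
    have [a Aa ya] := JA y Jy eta eta0; have [k kn ak] := cov a Aa.
    exists (Ordinal kn) => //; split=> //=.
    by rewrite (le_trans (enorm_triangle a _ _)) //; lra.
  apply/ediam_leP => [|x y [Jx xk] [Jy yk]].
    by rewrite divr_ge0 ?mulr_ge0 // ltW.
  rewrite ler_pdivlMr // mulrC.
  apply: le_trans (word_map_lo _ (limit_set_sub Jx) (limit_set_sub Jy)) _.
  rewrite (le_trans (enorm_triangle (c k) _ _)) // [X in _ + X]enormB; lra.
rewrite lee_fin powRN -[leRHS]div1r ler_pdivlMr // powR_gt0 // mulr_gt0 //.
Qed.

Lemma upper_box_dim_le_packing_dim : (upper_box_dim J <= packing_dim J)%E.
Proof.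
apply: le_ereal_inf_tmp => _ [t [t0 Jt] <-].
have : (packing_measure t J < 1%:E)%E by rewrite Jt lte_fin.
move=> /ereal_inf_lt[_ [A [JA ->]] sumA].
have [w [k wk]] := limit_set_baire JA.
have : (packing_premeasure t (A k) < 1%:E)%E.
  apply: le_lt_trans sumA.
  rewrite nneseries_esumT; last by move=> j; exact: packing_premeasure_ge0.
  apply: esum_ge; exists [set k]; last by rewrite fsbig_set1.
  by split; [exact: finite_set1|].
move=> /ereal_inf_lt[_ [delta /= delta0 <-] /ltW PA].
apply/lee_addgt0Pr => e e0; rewrite -EFinD.
apply: upper_box_dim_le; first exact: limit_set_nonempty.
have low : 0 < \prod_(i <- w) lo i by rewrite prodr_gt0.
set l := \prod_(i <- w) lo i in low.
(* At scale x, eta = x l / 6 makes 6 eta / l equal to x. Then (2 eta)^-t = C x^-t, and the extra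
   exponent e absorbs C once x^e <= 1/C. *)
pose C := (l / 3) `^ (- t).
have C0 : 0 < C by rewrite powR_gt0 // divr_gt0.
near=> x.
have x0 : 0 < x by near: x; exact: nbhs_right_gt.
have xd : x <= 6 * delta / l.
  by near: x; apply: nbhs_right_le; rewrite divr_gt0 // mulr_gt0.
have xe : x `^ e <= C^-1 by near: x; apply: near0_powR_le; rewrite ?invr_gt0.
pose eta := x * l / 6.
have eta0 : 0 < eta by rewrite divr_gt0 // mulr_gt0.
have etad : 0 < eta <= delta.
  rewrite eta0 /eta; move: xd; rewrite ler_pdivlMr // => xd.
  by rewrite ler_pdivrMr // mulrC [delta * _]mulrC mulrC.
have := covering_number_limit_set_le wk etad PA.
have -> : 6 * eta / \prod_(i <- w) lo i = x.
  by rewrite -/l /eta; field; rewrite gt_eqF.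
move=> /le_trans; apply; rewrite lee_fin.
have -> : 2 * eta = x * (l / 3) by rewrite /eta; field.
rewrite powRM ?(ltW x0) ?(ltW (divr_gt0 low _)) // -/C opprD powRD; last first.
  by rewrite (gt_eqF x0) implybT.
rewrite ler_wpM2l ?powR_ge0 // powRN -[C]invrK lef_pV2 ?posrE ?invr_gt0 //.
exact: powR_gt0.
Unshelve. all: by end_near. Qed.

End LimitSet.

(** * Sequences with polynomial growth *)

Section PowerSums.
Variable R : realType.

(** A discrete integral test. From ln y <= y - 1 and exp u >= 1 + u one gets (x/(x+1))^b <=
    (x+1)/(x+1+b); the constant comes from x + 1 + b <= (2 + b) x, valid for x >= 1. *)
Lemma powR_telescope (b x : R) : 0 < b -> 1 <= x ->
  x `^ (- (1 + b)) <= (2 + b) / b * (x `^ (- b) - (x + 1) `^ (- b)).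
Proof.
move=> b0 x1; have x0 : 0 < x by lra.
have x1' : 0 < x + 1 by lra.
have y0 : 0 < x / (x + 1) by rewrite divr_gt0.
have lny : ln (x / (x + 1)) <= - (x + 1)^-1.
  have -> : x / (x + 1) = 1 + - (x + 1)^-1 by field; lra.
  by rewrite le_ln1Dx // ltrN2 invf_lt1 //; lra.
have powy : (x / (x + 1)) `^ b <= (x + 1) / (x + 1 + b).
  rewrite /powR gt_eqF //.
  apply: (@le_trans _ _ (expR (- (b / (x + 1))))).
    by rewrite ler_expR -mulrN ler_pM2l.
  rewrite expRN -[leRHS]invrK lef_pV2 ?posrE ?expR_gt0 ?invr_gt0 ?divr_gt0 //;
    last by lra.
  have -> : ((x + 1) / (x + 1 + b))^-1 = 1 + b / (x + 1) by field; lra.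
  exact: expR_ge1Dx.
have -> : (x + 1) `^ (- b) = x `^ (- b) * (x / (x + 1)) `^ b.
  rewrite powRM ?invr_ge0 ?ltW // mulrA -powRD ?(gt_eqF x0) ?implybT //.
  by rewrite addNr powRr0 mul1r -powR_inv1 ?ltW // -powRrM mulN1r.
have -> : x `^ (- (1 + b)) = x `^ (- b) * x^-1.
  rewrite opprD addrC powRD ?(gt_eqF x0) ?implybT // powR_inv1 //.
  exact: ltW.
rewrite -[X in X - _]mulr1 -mulrBr mulrCA ler_wpM2l ?powR_ge0 //.
apply: (@le_trans _ _ ((2 + b) / b * (b / (x + 1 + b)))); last first.
  rewrite ler_wpM2l ?divr_ge0 //; try lra.
  have -> : b / (x + 1 + b) = 1 - (x + 1) / (x + 1 + b) by field; lra.
  lra.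
have -> : (2 + b) / b * (b / (x + 1 + b)) = (2 + b) / (x + 1 + b) by field; lra.
rewrite ler_pdivlMr; last by lra.
rewrite mulrC ler_pdivrMr //; nra.
Qed.

Lemma esum_powR_le (b : R) (m : nat) : 0 < b -> (0 < m)%N ->
  (\esum_(n in [set: nat]) ((n + m)%:R `^ (- (1 + b)))%:E
     <= ((2 + b) / b * m%:R `^ (- b))%:E)%E.
Proof.
move=> b0 m0.
have := @esum_telescope_le R (fun n => (n + m)%:R `^ (- (1 + b)))
  (fun n => (2 + b) / b * (n + m)%:R `^ (- b)) 0.
rewrite add0n [X in esum X](_ : _ = [set: nat]); last by apply/seteqP; split.
apply=> n _; last by rewrite mulr_ge0 ?powR_ge0 // divr_ge0; lra.
rewrite powR_ge0 /= -mulrBr addSn -(natr1 (n + m)); apply: powR_telescope => //.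
by rewrite ler1n addn_gt0 m0 orbT.
Qed.

Lemma near_pinfty_powR (b M : R) : 0 < b ->
  \forall n \near \oo, M <= n%:R `^ b.
Proof.
move=> b0; exists (Num.truncn (`|M| `^ b^-1)).+1 => // n /= nM.
have M0 := powR_ge0 `|M| b^-1.
have : `|M| `^ b^-1 <= n%:R.
  by rewrite (le_trans (ltW (truncnS_gt _))) // ler_nat.
move=> /(ge0_ler_powR (ltW b0)) -/(_ _ _) H.
rewrite (le_trans (ler_norm M)) // (le_trans _ (H _ _)) ?nnegrE //.
by rewrite -powRrM mulVf ?gt_eqF // powRr1.
Qed.

End PowerSums.

Section LowerBox.
Variables (R : realType) (d : nat).

(** At scale x the first x^-t or so points are still more than x apart, because their mutual
    distances are of order at least x^(ta) with ta < 1. *)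
Lemma lower_box_dim_ge_separated (F : set 'rV[R]_d) (p : nat -> 'rV[R]_d)
    (c a t : R) (m : nat) :
  0 < c -> 0 < a -> 0 < t -> t * a < 1 -> (0 < m)%N -> (forall n, F (p n)) ->
  (forall n k, (n < k)%N -> c * (n + m)%:R `^ (- a) <= enorm (p n - p k)) ->
  (t%:E <= lower_box_dim F)%E.
Proof.
move=> c0 a0 t0 ta1 m0 Fp sep; apply: lower_box_dim_ge.
have c2 : 0 < c * 2 `^ (- a) / 2 by rewrite divr_gt0 // mulr_gt0 ?powR_gt0.
near=> x.
have x0 : 0 < x by near: x; exact: nbhs_right_gt.
have xt : x `^ t <= (1 + m%:R)^-1.
  by near: x; apply: near0_powR_le.
have xta : x `^ (1 - t * a) <= c * 2 `^ (- a) / 2.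
  by near: x; apply: near0_powR_le; rewrite ?subr_gt0.
set y := x `^ (- t).
have y0 : 0 < y by rewrite powR_gt0.
have ym : 1 + m%:R <= y.
  by rewrite /y powRN -[leLHS]invrK lef_pV2 ?posrE ?invr_gt0 ?powR_gt0 //.
pose M := (Num.truncn y).+1.
have yM : y < M%:R by exact: truncnS_gt.
have My : M%:R <= y + 1 by rewrite -natr1 lerD2r truncn_le ltW.
apply: (@le_trans _ _ (M%:R)%:E); first by rewrite lee_fin ltW.
(* Since i < M <= y + 1 and 1 + m <= y, the base i + m is at most 2y, so the distance is at least c
   2^-a x^(ta); the factor 1/2 in [xta] makes the comparison with x strict. *)
have lt_sep (i j : 'I_M) : (i < j)%N -> x < enorm (p i - p j).
  move=> ij; apply: lt_le_trans (sep _ _ ij).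
  apply: (@lt_le_trans _ _ (c * (2 * y) `^ (- a))); last first.
    rewrite ler_wpM2l ?(ltW c0) // !powRN lef_pV2 ?posrE ?powR_gt0 ?mulr_gt0 //;
      last by rewrite ltr0n addn_gt0 m0 orbT.
    rewrite ge0_ler_powR ?nnegrE ?(ltW a0) //; first by rewrite mulr_ge0 // ltW.
    have : (i : nat)%:R < M%:R :> R by rewrite ltr_nat.
    rewrite natrD; lra.
  rewrite powRM ?ltW // /y -powRrM mulrNN mulrA.
  have xE : x = x `^ (1 - t * a) * x `^ (t * a).
    rewrite -powRD ?(gt_eqF x0) ?implybT // subrK powRr1 //; exact: ltW.
  rewrite {1}xE ltr_pM2r ?powR_gt0 //.
  by rewrite (le_lt_trans xta) // ltr_pdivrMr // ltr_pMr ?mulr_gt0 ?powR_gt0 // ltr1n.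
rewrite -(card_ord M); apply: (covering_number_ge (p := p \o val)) => // [i|i j ij].
  exact: Fp.
have [lij|lji|/val_inj eij] := ltngtP i j.
- exact: lt_sep.
- by rewrite enormB; exact: lt_sep.
- by rewrite eij eqxx in ij.
Unshelve. all: by end_near. Qed.

End LowerBox.

(** * The two systems on the disc *)

Section PlaneMaps.
Variable R : realType.
Local Open Scope complex_scope.
Implicit Types (z w alpha : R[i]) (r : R).
Local Notation normc := (@Normc.normc R).

Lemma C_to_R2K : cancel (@C_to_R2 R) (@R2_to_C R).
Proof. by case=> a b; rewrite /R2_to_C !mxE /=. Qed.

Lemma R2_to_CK : cancel (@R2_to_C R) (@C_to_R2 R).
Proof.
move=> v; apply/rowP => k; rewrite !mxE.
by case: k => -[|[|//]] k2 /=; congr (v _ _); apply: val_inj.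
Qed.

Lemma C_to_R2B z w : C_to_R2 (z - w) = C_to_R2 z - C_to_R2 w.
Proof.
by apply/rowP => k; rewrite !mxE; case: ifP => _; rewrite raddfB.
Qed.

Lemma enorm_C_to_R2 z : enorm (C_to_R2 z) = normc z.
Proof.
case: z => a b; rewrite /enorm /edot big_ord_recl big_ord1 !mxE /=.
by rewrite -!expr2.
Qed.

Lemma normc_real r : 0 <= r -> normc r%:C = r.
Proof. by move=> r0; rewrite /= expr0n addr0 sqrtr_sqr ger0_norm. Qed.

Lemma normcR z : `|z| = (normc z)%:C.
Proof. by case: z. Qed.

Lemma normc_e2pi r : normc (e2pi r) = 1.
Proof. by rewrite /= cos2Dsin2 sqrtr1. Qed.

Lemma closed_discE (v : 'rV[R]_2) : closed_disc v <-> normc (R2_to_C v) <= 1.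
Proof.
split=> [[z z1 <-]|v1].
  by rewrite C_to_R2K -lecR -normcR.
by exists (R2_to_C v); rewrite ?R2_to_CK //= normcR lecR.
Qed.

Lemma normcD z w : normc (z + w) <= normc z + normc w.
Proof. exact: le_normcD. Qed.

Lemma normcB z w : normc (z - w) = normc (w - z).
Proof. by rewrite -[RHS](normcN (w - z : Rcomplex R)) opprB. Qed.

Lemma normcD_ge z w : normc w - normc z <= normc (z + w).
Proof.
have := normcD (z + w) (- z); rewrite addrAC subrr add0r.
by rewrite (normcN (z : Rcomplex R)); lra.
Qed.

Lemma Re_le_normc z : `|complex.Re z| <= normc z.
Proof. by rewrite -lecR -normcR; exact: normc_ge_Re. Qed.

Lemma enorm_on_R2 (h : R[i] -> R[i]) (u v : 'rV[R]_2) :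
  enorm (on_R2 h u - on_R2 h v) = normc (h (R2_to_C u) - h (R2_to_C v)).
Proof. by rewrite /on_R2 /= -C_to_R2B enorm_C_to_R2. Qed.

Lemma R2_to_C_on_R2 (h : R[i] -> R[i]) v : R2_to_C (on_R2 h v) = h (R2_to_C v).
Proof. exact: C_to_R2K. Qed.

Lemma Re_on_R2 (h : R[i] -> R[i]) v :
  on_R2 h v ord0 ord0 = complex.Re (h (R2_to_C v)).
Proof. by rewrite mxE. Qed.

Lemma enorm_R2_to_C (u v : 'rV[R]_2) :
  enorm (u - v) = normc (R2_to_C u - R2_to_C v).
Proof. by rewrite -[u in LHS]R2_to_CK -[v in LHS]R2_to_CK -C_to_R2B enorm_C_to_R2. Qed.

(* What f_alpha and g_alpha with |alpha| = D have in common; nothing else about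
   them matters.  The bound 4 / D^2 needs D >= 2. *)
Record disc_system (D : nat -> R) (T : nat)
    (s : nat * 'I_T -> 'rV[R]_2 -> 'rV[R]_2) : Prop := DiscSystem {
  ds_disc : forall p x, closed_disc x -> closed_disc (s p x);
  ds_up : forall p x y, closed_disc x -> closed_disc y ->
    enorm (s p x - s p y) <= 4 / D p.1 ^+ 2 * enorm (x - y);
  ds_lo : forall p x y, closed_disc x -> closed_disc y ->
    (D p.1 + 1) ^- 2 * enorm (x - y) <= enorm (s p x - s p y);
  ds_real : forall (p : nat * 'I_T) x, (p.2 : nat) = 0%N -> closed_disc x ->
    (D p.1 + 1)^-1 <= s p x ord0 ord0 <= (D p.1 - 1)^-1 }.

Section DiscMaps.
Variables (d : nat -> R) (T : nat).
Hypothesis d2 : forall n, 2 <= d n.+1.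

Lemma normc_param (p : nat * 'I_T) : normc (param d p) = d p.1.+1.
Proof.
have := d2 p.1 => dp.
by rewrite Normc.normcM normc_e2pi mul1r normc_real //; lra.
Qed.

Lemma param0 (p : nat * 'I_T) : (p.2 : nat) = 0%N -> param d p = (d p.1.+1)%:C.
Proof. by move=> p0; rewrite /param p0 mul0r /e2pi mulr0 cos0 sin0 mul1r. Qed.

Lemma f_map_denom (p : nat * 'I_T) : `|param d p| ^+ 2 - 1 = (d p.1.+1 ^+ 2 - 1)%:C.
Proof. by rewrite normcR normc_param rmorphB rmorphXn rmorph1. Qed.

Lemma calF_disc_system : disc_system (fun n => d n.+1) (@calF R d T).
Proof.
have denom p : 0 < d (p : nat * 'I_T).1.+1 ^+ 2 - 1 by have := d2 p.1; nra.
have dist (p : nat * 'I_T) x y : enorm (calF d p x - calF d p y) =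
    (d p.1.+1 ^+ 2 - 1)^-1 * enorm (x - y).
  rewrite enorm_on_R2 enorm_R2_to_C /f_map f_map_denom.
  rewrite -mulrBl opprD addrACA subrr addr0.
  by rewrite Normc.normcM Normc.normcV normc_real ?(ltW (denom p)) // mulrC.
split=> p.
- move=> x /closed_discE x1; apply/closed_discE.
  rewrite /calF R2_to_C_on_R2 /f_map f_map_denom.
  rewrite Normc.normcM Normc.normcV normc_real ?(ltW (denom p)) // ler_pdivrMr // mul1r.
  rewrite (le_trans (normcD _ _)) //.
  have -> : normc (param d p)^* = d p.1.+1.
    by rewrite -normc_param; case: (param d p) => a b /=; rewrite sqrrN.
  by have := d2 p.1; nra.
- move=> x y _ _; rewrite dist ler_wpM2r ?enorm_ge0 //.
  have := d2 p.1 => dp.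
  by rewrite ler_pdivlMr ?exprn_gt0 // ?ler_pdivrMl //; [nra|lra].
- move=> x y _ _; rewrite dist ler_wpM2r ?enorm_ge0 // lef_pV2 ?posrE //.
    by have := d2 p.1; nra.
  by have := d2 p.1 => dp; rewrite exprn_gt0 //; lra.
- move=> x p0 /closed_discE x1; rewrite /calF Re_on_R2 /f_map.
  rewrite f_map_denom param0 // -fmorphV.
  have := le_trans (Re_le_normc _) x1; rewrite ler_norml.
  case: (R2_to_C x) => a b /= /andP[a0 a1].
  have := denom p; have := d2 p.1; set D := d _ => D2 D0.
  rewrite mulr0 subr0.
  apply/andP; split.
    rewrite ler_pdivlMr // ler_pdivrMl; [nra|lra].
  rewrite ler_pdivrMr // ler_pdivlMl; [nra|lra].
Qed.

(** All bounds come from |g(x) - g(y)| = |x - y| / (|x + alpha| |y + alpha|), where both factors lie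
    between D - 1 and D + 1, and D - 1 >= D/2. *)
Lemma calG_disc_system : disc_system (fun n => d n.+1) (@calG R d T).
Proof.
have denom (p : nat * 'I_T) x : closed_disc x ->
    d p.1.+1 - 1 <= normc (R2_to_C x + param d p) <= d p.1.+1 + 1.
  move=> /closed_discE x1; apply/andP; split.
    by apply: le_trans (normcD_ge _ _); rewrite normc_param; lra.
  by rewrite (le_trans (normcD _ _)) // normc_param; lra.
have denom0 (p : nat * 'I_T) x : closed_disc x -> R2_to_C x + param d p != 0.
  move=> /(denom p) /andP[+ _]; apply: contraTneq => ->.
  by rewrite Normc.normc0 -ltNge; have := d2 p.1; lra.
have dist (p : nat * 'I_T) x y : closed_disc x -> closed_disc y ->
    enorm (calG d p x - calG d p y) =
    (normc (R2_to_C x + param d p))^-1 * (normc (R2_to_C y + param d p))^-1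
      * enorm (x - y).
  move=> x1 y1; rewrite enorm_on_R2 enorm_R2_to_C /g_map !div1r.
  rewrite -!Normc.normcV normcB -!Normc.normcM; congr normc.
  by field; rewrite !denom0.
split=> p.
- move=> x x1; apply/closed_discE; have /andP[dx _] := denom p x x1.
  rewrite /calG R2_to_C_on_R2 /g_map div1r Normc.normcV.
  by have := d2 p.1 => dp; rewrite invf_le1; lra.
- move=> x y x1 y1; rewrite dist // ler_wpM2r ?enorm_ge0 //.
  have /andP[dx _] := denom p x x1; have /andP[dy _] := denom p y y1.
  have := d2 p.1; move: dx dy; set D := d _; set u := normc _; set v := normc _.
  move=> du dv D2.
  by rewrite -invfM ler_pdivlMr ?exprn_gt0 // ?ler_pdivrMl //; [nra|nra|lra].
- move=> x y x1 y1; rewrite dist // ler_wpM2r ?enorm_ge0 // -invfM.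
  have /andP[dx dx'] := denom p x x1; have /andP[dy dy'] := denom p y y1.
  have := d2 p.1; move: dx dy dx' dy'; set D := d _.
  set u := normc _; set v := normc _ => du dv du' dv' D2.
  by rewrite lef_pV2 ?posrE ?exprn_gt0 //; [nra|lra|nra].
- move=> x p0 x1; rewrite /calG Re_on_R2 /g_map param0 // div1r.
  move: x1 => /closed_discE.
  case: (R2_to_C x) => a b /=.
  rewrite -[leRHS]sqrtr1 ler_psqrt ?nnegrE ?addr_ge0 ?sqr_ge0 // => ab1.
  have := d2 p.1; set D := d _ => D2.
  rewrite addr0.
  have a2 : -1 <= a <= 1 by nra.
  have /andP[a3 a4] := a2.
  have n0 : 0 < (a + D) ^+ 2 + b ^+ 2 by nra.
  apply/andP; split.
    rewrite ler_pdivlMr // ler_pdivrMl; [nra|lra].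
  rewrite ler_pdivrMr // ler_pdivlMl; [nra|lra].
Qed.

End DiscMaps.

End PlaneMaps.

(** * Dimensions of the limit set of a disc system *)

Section DiscSystem.
Variables (R : realType) (D : nat -> R) (T : nat).
Variable s : nat * 'I_T -> 'rV[R]_2 -> 'rV[R]_2.
Hypothesis cX : compact (@closed_disc R).
Hypothesis T_gt0 : (0 < T)%N.
Hypothesis D_ge4 : forall n, 4 <= D n.
Hypothesis Ds : disc_system D s.

Local Notation X := (@closed_disc R).
Local Notation J := (limit_set X s).

Let lo (p : nat * 'I_T) := (D p.1 + 1) ^- 2.
Let up (p : nat * 'I_T) := 4 / D p.1 ^+ 2.

Let D_gt0 n : 0 < D n.
Proof. by have := D_ge4 n; lra. Qed.

Let lo_gt0 p : 0 < lo p.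
Proof. by rewrite invr_gt0 exprn_gt0 // addr_gt0. Qed.

Let up_gt0 p : 0 < up p.
Proof. by rewrite divr_gt0 // exprn_gt0. Qed.

(** At D = 2 the bound 4/D^2 is only 1; hence the stronger requirement D >= 4 here. *)
Let up_le p : up p <= 4^-1.
Proof.
rewrite /up ler_pdivrMr ?exprn_gt0 // ler_pdivlMl //.
by have := D_ge4 p.1; nra.
Qed.

Let X0 : X !=set0.
Proof.
exists 0; apply/closed_discE; rewrite -enorm_C_to_R2 R2_to_CK enorm0.
exact: ler01.
Qed.

Let diamX x y : X x -> X y -> enorm (x - y) <= 2.
Proof.
move=> /closed_discE x1 /closed_discE y1; rewrite enorm_R2_to_C.
rewrite (le_trans (normcD _ _)) // (_ : Normc.normc (- _) = Normc.normc (R2_to_C y)).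
  lra.
exact: normcN.
Qed.

Let quarter_lt1 : (4^-1 : R) < 1.
Proof. by rewrite invf_lt1 // ltr1n. Qed.

Let j0 : 'I_T := Ordinal T_gt0.

Let J0 : J !=set0.
Proof. exact: (limit_set_nonempty (0%N, j0) cX X0 (ds_disc Ds) (ds_up Ds) up_gt0). Qed.

Lemma disc_system_packing_dim : upper_box_dim J = packing_dim J.
Proof.
apply/eqP; rewrite eq_le packing_dim_le_upper_box // andbT.
exact: (upper_box_dim_le_packing_dim (0%N, j0) cX X0 diamX (ds_disc Ds) (ds_up Ds)
  (ds_lo Ds) lo_gt0 up_gt0 up_le quarter_lt1).
Qed.

(** The number b measures the excess of sigma over 1/(2 gamma): the ratios to the power sigma decay
    like n^-(1+b), and their tail from m on like m^-b. The factor T counts the rotations of each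
    modulus. *)
Lemma disc_system_hausdorff_dim (c gamma b sigma : R) (m : nat) :
  0 < c -> 0 < b -> 0 <= sigma -> 2 * gamma * sigma = 1 + b -> (0 < m)%N ->
  (forall n, c * (n + m)%:R `^ gamma <= D n) ->
  T%:R * ((4 / c ^+ 2) `^ sigma * ((2 + b) / b * m%:R `^ (- b))) < 1 ->
  (hausdorff_dim J <= sigma%:E)%E.
Proof.
move=> c0 b0 sigma0 bE m0 Dc; set theta := (X in X < 1) => theta1.
apply: (hausdorff_dim_limit_set_le (0%N, j0) X0 diamX (ds_disc Ds) (ds_up Ds)
  up_gt0 up_le quarter_lt1 sigma0 theta1).
rewrite (_ : [set: nat * 'I_T] = [set: nat] `*`` fun=> [set: 'I_T]); last first.
  by apply/seteqP; split.
rewrite -(esum_esum (a := fun n (j : 'I_T) => (up (n, j) `^ sigma)%:E)); last first.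
  by move=> n j _ _; rewrite lee_fin powR_ge0.
apply: (@le_trans _ _ (\esum_(n in [set: nat])
   ((T%:R * (4 / c ^+ 2) `^ sigma)%:E * ((n + m)%:R `^ (- (1 + b)))%:E))%E); last first.
  rewrite /theta mulrA; apply: esumZ_le => [|n|].
  - by rewrite mulr_ge0 // powR_ge0.
  - by rewrite lee_fin powR_ge0.
  - exact: esum_powR_le.
apply: le_esum => n _.
rewrite (_ : [set: 'I_T] = [set` enum 'I_T]); last first.
  by apply/seteqP; split=> // j _ /=; rewrite mem_enum.
rewrite esum_fset; [|exact: finite_seq|by move=> j _; rewrite lee_fin powR_ge0].
rewrite -fsbig_seq ?enum_uniq // sumEFin /up /= big_const_seq count_predT size_enum_ord.
rewrite iter_addr_0 -EFinM lee_fin -[leLHS]mulr_natl -mulrA.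
rewrite ler_wpM2l //.
have nm0 : 0 < (n + m)%:R :> R by rewrite ltr0n addn_gt0 m0 orbT.
have -> : (n + m)%:R `^ (- (1 + b)) = ((n + m)%:R `^ (- (2 * gamma))) `^ sigma.
  by rewrite -powRrM mulNr bE.
rewrite -powRM ?powR_ge0 ?divr_ge0 ?sqr_ge0 // ge0_ler_powR ?nnegrE //.
- by rewrite divr_ge0 ?sqr_ge0.
- by rewrite mulr_ge0 ?powR_ge0 ?divr_ge0 ?sqr_ge0.
have y0 : 0 < c * (n + m)%:R `^ gamma by rewrite mulr_gt0 ?powR_gt0.
rewrite [leRHS](_ : _ = 4 / (c * (n + m)%:R `^ gamma) ^+ 2); last first.
  rewrite powRN mulrC [2 * _]mulrC powRrM powR_mulrn ?powR_ge0 //.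
  by field; rewrite !gt_eqF ?powR_gt0.
rewrite ler_wpM2l // lef_pV2 ?posrE ?exprn_gt0 //.
by rewrite ler_sqr ?nnegrE ?Dc // ltW.
Qed.

Lemma disc_system_lower_box_dim (c a t : R) (m : nat) :
  0 < c -> 0 < a -> 0 < t -> t * a < 1 -> (0 < m)%N ->
  (forall n k, (n < k)%N ->
    c * (n + m)%:R `^ (- a) <= (D n + 1)^-1 - (D k - 1)^-1) ->
  (t%:E <= lower_box_dim J)%E.
Proof.
move=> c0 a0 t0 ta m0 gap; have [x Jx] := J0.
have Xx : X x by exact: limit_set_sub (ds_disc Ds) _ Jx.
(* One limit point x is moved by the unrotated maps, and only real parts are compared. *)
apply: (lower_box_dim_ge_separated (p := fun n => s (n, j0) x) c0 a0 t0 ta m0).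
  by move=> n; exact: limit_set_map (ds_disc Ds) _ _ Jx.
move=> n k nk; apply: le_trans (gap _ _ nk) _.
apply: le_trans (ler_coord_enorm _ ord0); rewrite !mxE.
apply: le_trans (ler_norm _).
have /andP[xn _] := ds_real Ds (p := (n, j0)) erefl Xx.
have /andP[_ xk] := ds_real Ds (p := (k, j0)) erefl Xx.
exact: lerB.
Qed.

End DiscSystem.

(** * Gaps between reciprocals of the sequence *)

Section Growth.
Variables (R : realType) (d : nat -> R) (c1 c2 c3 gamma : R) (N : nat).
Hypotheses (hd : in_calD d) (hc1 : 0 < c1) (hc3 : 0 < c3) (hgamma : 1 < gamma).
Hypothesis hgrowth : forall n : nat, (N <= n)%N ->
  c1 * n%:R `^ gamma <= d n <= c2 * n%:R `^ gamma.
Hypothesis hgap : forall n : nat, (N <= n)%N ->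
  c3 * n%:R `^ (gamma - 1) <= d n.+1 - d n.

Lemma calD_ge n : (0 < n)%N -> 2 * n%:R <= d n.
Proof.
have [d1 dS] := hd; elim: n => // -[|n] IH _; first by rewrite mulr1.
by have := IH isT; have := dS n.+1 isT; rewrite -[n.+2%:R]natr1; lra.
Qed.

Lemma calD_le n k : (0 < n)%N -> (n <= k)%N -> d n <= d k.
Proof.
move=> n0 /subnKC <-; elim: (k - n)%N => [|j IH]; first by rewrite addn0.
rewrite addnS; have [_ dS] := hd; have := dS (n + j)%N; rewrite addn_gt0 n0.
by move=> /(_ isT); lra.
Qed.

(** By monotonicity k = n + 1 is the worst case. There the difference is (d_(n+1) - d_n - 2) over a
    product of order n^(2 gamma); the numerator is of order at least n^(gamma-1), and (gamma - 1) -
    2 gamma = -(1 + gamma). *)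
Lemma calD_gap : exists2 c, 0 < c & \forall n \near \oo, forall k, (n < k)%N ->
  c * n%:R `^ (- (1 + gamma)) <= (d n + 1)^-1 - (d k - 1)^-1.
Proof.
have c2_gt0 : 0 < c2.
  have n0 : 0 < N.+1%:R `^ gamma :> R by rewrite powR_gt0.
  have /andP[l1 l2] := hgrowth (leqnSn N).
  rewrite -(pmulr_lgt0 _ n0); apply: lt_le_trans (le_trans l1 l2).
  by rewrite mulr_gt0.
(* One factor 2 absorbs the 1 in d_n + 1, and 2^gamma comes from n + 1 <= 2n. *)
pose K := 2 * c2 * (c2 * 2 `^ gamma).
have K0 : 0 < K by rewrite !mulr_gt0 ?powR_gt0.
exists (c3 / 2 / K); first by rewrite !divr_gt0.
near=> n => k nk.
have Nn : (N <= n)%N by near: n; exact: nbhs_infty_ge.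
have n0 : (0 < n)%N by near: n; exact: nbhs_infty_gt.
(* Half of the gap c3 n^(gamma-1) then pays for the 2 subtracted in the numerator. *)
have big : 4 / c3 <= n%:R `^ (gamma - 1).
  by near: n; apply: near_pinfty_powR; rewrite subr_gt0.
have n0R : 0 < n%:R :> R by rewrite ltr0n.
have n1 : 1 <= n%:R :> R by rewrite ler1n.
have dn : 2 <= d n by have := calD_ge n0; lra.
have dnS : 2 <= d n.+1 by have := calD_ge (ltn0Sn n); rewrite -(natr1 n); lra.
have dk : d n.+1 <= d k by exact: calD_le.
have /andP[_ un] := hgrowth Nn; have /andP[_ unS] := hgrowth (leqW Nn).
have gap := hgap Nn.
apply: (@le_trans _ _ ((d n + 1)^-1 - (d n.+1 - 1)^-1)); last first.
  by rewrite lerD2l lerN2 lef_pV2 ?posrE; lra.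
rewrite ler_pdivrMr // mulrC in big.
have -> : (d n + 1)^-1 - (d n.+1 - 1)^-1 =
    (d n.+1 - d n - 2) / ((d n + 1) * (d n.+1 - 1)).
  by field; rewrite !gt_eqF //; lra.
set x := n%:R : R; set y := x `^ gamma.
have y0 : 0 < y by rewrite powR_gt0.
have unS' : d n.+1 <= c2 * 2 `^ gamma * y.
  apply: (le_trans unS); rewrite -mulrA ler_pM2l // /y -powRM //.
  have x1 : 1 <= x by [].
  have xS : n.+1%:R = x + 1 by rewrite -natr1.
  have gamma0 : 0 <= gamma by exact: ltW (lt_trans ltr01 hgamma).
  by apply: ge0_ler_powR; rewrite ?nnegrE ?xS; lra.
have -> : c3 / 2 / K * x `^ (- (1 + gamma)) =
    (c3 / 2 * x `^ (gamma - 1)) / (K * y ^+ 2).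
  have -> : x `^ (gamma - 1) = y / x.
    by rewrite powRD ?(gt_eqF n0R) ?implybT // powR_inv1 // ltW.
  rewrite opprD powRD ?(gt_eqF n0R) ?implybT // powR_inv1 ?(ltW n0R) // powRN.
  by rewrite -/y; field; rewrite !gt_eqF.
have denom : (d n + 1) * (d n.+1 - 1) <= K * y ^+ 2.
  have -> : K * y ^+ 2 = (2 * (c2 * y)) * (c2 * 2 `^ gamma * y) by rewrite /K; ring.
  have un' : d n <= c2 * y by [].
  by apply: ler_pM; lra.
have den0 : 0 < (d n + 1) * (d n.+1 - 1) by rewrite mulr_gt0; lra.
apply: ler_pM.
- by rewrite mulr_ge0 ?powR_ge0 // divr_ge0 // ltW.
- by rewrite invr_ge0 (le_trans (ltW den0)).
- by move: gap big; rewrite -/x; lra.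
- by rewrite lef_pV2 ?posrE // (lt_le_trans den0).
Unshelve. all: by end_near. Qed.

End Growth.

(** The quantifier over s stands inside the one over l, so one threshold serves both systems. *)
Lemma limit_set_dims (R : realType) (d : nat -> R) (T : nat)
    (c1 c2 c3 gamma : R) (N : nat) :
  in_calD d -> (1 <= T)%N -> 0 < c1 -> 0 < c3 -> 1 < gamma ->
  (forall n : nat, (N <= n)%N ->
     c1 * n%:R `^ gamma <= d n <= c2 * n%:R `^ gamma) ->
  (forall n : nat, (N <= n)%N ->
     c3 * n%:R `^ (gamma - 1) <= d n.+1 - d n) ->
  compact (@closed_disc R) ->
  \forall l \near \oo, forall s,
    disc_system (fun n => shift_seq l d n.+1) s ->
    let J := limit_set (@closed_disc R) (s : nat * 'I_T -> _) in
    (hausdorff_dim J < lower_box_dim J)%E /\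
    (lower_box_dim J <= upper_box_dim J)%E /\ upper_box_dim J = packing_dim J.
Proof.
move=> hd hT hc1 hc3 hgamma hgrowth hgap cX.
have [c c0 [n0 _ gap]] := calD_gap hd hc1 hc3 hgamma hgrowth hgap.
have g1 : 0 < 1 + gamma by lra.
have g2 : 0 < 2 * gamma by lra.
have h12 : (2 * gamma)^-1 < (1 + gamma)^-1 by rewrite ltf_pV2 ?posrE //; lra.
(* Two midpoints give 1/(2 gamma) < sigma < t < 1/(1 + gamma): sigma bounds the Hausdorff dimension
   from above, t the lower box dimension from below. *)
have [s1 s2] := midf_lt h12; set sigma := (X in _ < X) in s1; rewrite -/sigma in s2.
have [t1 t2] := midf_lt s2; set t := (X in _ < X) in t1; rewrite -/t in t2.
have sigma0 : 0 < sigma by apply: lt_trans s1; rewrite invr_gt0.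
have t0 : 0 < t by exact: lt_trans t1.
have ta : t * (1 + gamma) < 1 by rewrite -ltr_pdivlMr // div1r.
pose b := 2 * gamma * sigma - 1.
have b0 : 0 < b by rewrite subr_gt0 mulrC -ltr_pdivrMr // div1r.
have bE : 2 * gamma * sigma = 1 + b by rewrite addrC subrK.
pose C := T%:R * ((4 / c1 ^+ 2) `^ sigma * ((2 + b) / b)).
near=> l => s.
have l2 : (2 <= l)%N by near: l; exact: nbhs_infty_ge.
have l0 : (0 < l)%N by exact: leq_trans l2.
have ln0 : (n0 <= l)%N by near: l; exact: nbhs_infty_ge.
have lN : (N <= l)%N by near: l; exact: nbhs_infty_ge.
have shiftE n : shift_seq l d n.+1 = d (n + l)%N.
  by rewrite /shift_seq addSn subn1.
rewrite (_ : (fun n => _) = (fun n => d (n + l)%N)); last by apply/funext.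
move=> Ds /=.
have D4 n : 4 <= d (n + l)%N.
  have nl0 : (0 < n + l)%N by rewrite addn_gt0 l0 orbT.
  apply: le_trans (calD_ge hd nl0).
  have : (2 : R) <= (n + l)%:R by rewrite ler_nat (leq_trans l2) // leq_addl.
  lra.
split; last first.
  split; [exact: lower_box_dim_le_upper|exact: disc_system_packing_dim Ds].
apply: (@le_lt_trans _ _ sigma%:E); last first.
  apply: (@lt_le_trans _ _ t%:E); first by rewrite lte_fin.
  apply: (@disc_system_lower_box_dim _ _ _ _ cX hT D4 Ds c (1 + gamma) t l) => //.
  move=> n k nk.
  apply: gap; last by rewrite ltn_add2r.
  by rewrite /= (leq_trans ln0) // leq_addl.
apply: (@disc_system_hausdorff_dim _ _ _ _ hT D4 Ds c1 gamma b sigma l) => //.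
- exact: ltW.
- move=> n; have /hgrowth/andP[] // : (N <= n + l)%N.
  by rewrite (leq_trans lN) // leq_addl.
(* The contraction sum is at most C l^-b, which this makes smaller than 1. *)
have lC : C + 1 <= l%:R `^ b by near: l; exact: near_pinfty_powR.
rewrite mulrA mulrA -[X in X * _ < _]mulrA -/C powRN ltr_pdivrMr.
  lra.
by rewrite powR_gt0 // ltr0n.
Unshelve. all: by end_near. Qed.

Theorem theorem3 (R : realType) (d : nat -> R) (T : nat)
  (c1 c2 c3 gamma : R) (N : nat)
  (hd : in_calD d) (hT : (1 <= T)%N)
  (hc1 : 0 < c1) (hc12 : c1 <= c2) (hc3 : 0 < c3) (hgamma : 1 < gamma)
  (hN : (1 <= N)%N)
  (hgrowth : forall n : nat, (N <= n)%N ->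
     c1 * n%:R `^ gamma <= d n <= c2 * n%:R `^ gamma)
  (hgap : forall n : nat, (N <= n)%N ->
     c3 * n%:R `^ (gamma - 1) <= d n.+1 - d n)
  (hc1N : 1 < c1 * N%:R `^ gamma)
  (hF : is_CIFS (@closed_disc R) (@calF R d T))
  (hG : is_CIFS (@closed_disc R) (@calG R d T)) :
  exists q : nat, (1 <= q)%N /\
    forall l : nat, (q <= l)%N ->
      ((hausdorff_dim (JF (shift_seq l d) T)
          < lower_box_dim (JF (shift_seq l d) T))%E /\
       (lower_box_dim (JF (shift_seq l d) T)
          <= upper_box_dim (JF (shift_seq l d) T))%E /\
       upper_box_dim (JF (shift_seq l d) T)
          = packing_dim (JF (shift_seq l d) T)) /\
      ((hausdorff_dim (JG (shift_seq l d) T)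
          < lower_box_dim (JG (shift_seq l d) T))%E /\
       (lower_box_dim (JG (shift_seq l d) T)
          <= upper_box_dim (JG (shift_seq l d) T))%E /\
       upper_box_dim (JG (shift_seq l d) T)
          = packing_dim (JG (shift_seq l d) T)).
Proof.
have [[[cX _] _ _ _ _] _ _ _] := hF.
have [q _ dims] := limit_set_dims hd hT hc1 hc3 hgamma hgrowth hgap cX.
(* The successor forces l > 0, so that every index n + l is positive and the value of d at 0 is
   never reached. *)
exists q.+1; split=> // l ql.
have l0 : (0 < l)%N by exact: leq_ltn_trans ql.
have shift_ge2 n : 2 <= shift_seq l d n.+1.
  rewrite /shift_seq addSn subn1 /=.
  have nl0 : (0 < n + l)%N by rewrite addn_gt0 l0 orbT.
  apply: le_trans (calD_ge hd nl0).
  by rewrite -[leLHS]mulr1 ler_pM2l // ler1n.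
split; apply: (dims l (ltnW ql)).
- exact: calF_disc_system.
- exact: calG_disc_system.
Qed.
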